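(* Let $M$ be an oriented smooth hypersurface embedded in a Weitzenböck $(n+1)$-manifold $\tilde M$ with parallel totally skew-symmetric torsion. Let $g\colon M\to\mathbb{S}^n$ be the Gauss map. Then, under the identification $\phi\colon TM\to g^*T\mathbb{S}^n$, $-\phi^{-1}\Delta g=\operatorname{grad}H$, where $H$ is the mean curvature. In particular, if $M$ is connected, the Gauss map is harmonic if and only if $M$ has constant mean curvature.
   Context: A Weitzenböck $(n+1)$-manifold $\tilde M$ is a smooth $(n+1)$-manifold with a fixed global smooth frame $(\tilde E_1,\dots,\tilde E_{n+1})$, equipped with the orientation and the metric making this frame oriented orthonormal, and with the metric-compatible flat connection $\tilde\nabla$ determined by $\tilde\nabla\tilde E_i=0$ for all $i$. Its torsion is $\tilde T(X,Y)=\tilde\nabla_XY-\tilde\nabla_YX-[X,Y]$. The torsion is parallel if $\tilde\nabla\tilde T=0$, and totally skew-symmetric if $(X,Y,Z)\mapsto\langle X,\tilde T(Y,Z)\rangle$ is alternating. An oriented smooth hypersurface $M\subset\tilde M$ carries the restricted metric $\langle\cdot,\cdot\rangle$ and the projected metric-compatible connection $\nabla_XY=(\tilde\nabla_XY)^\top$ (tangential part). $N$ is the unit normal vector field along $M$ such that a frame $(E_1,\dots,E_n)$ of $M$ is oriented iff $(N,E_1,\dots,E_n)$ is oriented in $\tilde M$. The Weingarten map $W$ is the $(1,1)$-tensor field on $M$ with $\langle WX,Y\rangle=\langle N,\tilde\nabla_XY\rangle$; the mean curvature is $H=\operatorname{tr}W$. $\operatorname{grad}f$ is the metric dual of $\mathrm{d}f$.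 Gauss map: writing $N=\sum_iN^i\tilde E_i$, $g=(N^1,\dots,N^{n+1})\colon M\to\mathbb{S}^n$. Identification: for $p\in M$ the linear isometry $\phi\colon T_p\tilde M\to\mathbb{R}^{n+1}$ sending a vector to its coefficient vector relative to $(\tilde E_i|_p)$ sends $N|_p$ to $g(p)$ and restricts to an isometry $T_pM\to T_{g(p)}\mathbb{S}^n$; this gives a vector bundle isomorphism $\phi\colon TM\to g^*T\mathbb{S}^n$. The Laplacian (tension field) of $g$ is $\Delta g=\sum_i\big[(g^*\nabla^{\mathbb{S}^n})_{E_i}(\mathrm{d}g(E_i))-\mathrm{d}g(\nabla_{E_i}E_i)\big]$ for a local orthonormal frame $(E_i)$ of $M$, where $\nabla^{\mathbb{S}^n}$ is the Levi-Civita connection of the round metric; $g$ is harmonic iff $\Delta g=0$ everywhere. *)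

(* Defs.v *)
From HB Require Import structures.
From mathcomp Require Import all_boot all_order all_algebra.
From mathcomp Require Import all_classical all_reals all_analysis.

Set Implicit Arguments.
Unset Strict Implicit.
Unset Printing Implicit Defensive.

Import Order.TTheory GRing.Theory Num.Theory.
Import numFieldNormedType.Exports.

Local Open Scope classical_set_scope.
Local Open Scope ring_scope.

Section Euclidean.
Context {R : realType}.

Definition dot {m : nat} (u v : 'rV[R]_m) : R := \sum_i u 0 i * v 0 i.

(* Meant for open [U] only. *)
Fixpoint Ck (k : nat) {V W : normedModType R} (U : set V) (f : V -> W) : Prop :=
  match k with
  | 0 => forall x, U x -> {for x, continuous f}
  | k'.+1 => (forall x, U x -> differentiable f x) /\
             (forall v, Ck k' U (fun x => 'D_v f x))
  end.

Definition smooth {V W : normedModType R} (U : set V) (f : V -> W) : Prop :=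
  forall k, Ck k U f.

End Euclidean.

(* [ch_inv] is only meaningful on the open set [ch_map @` ch_dom]. *)
Record chart (R : realType) (m : nat) (T : topologicalType) := Chart {
  ch_dom : set T;
  ch_map : T -> 'rV[R]_m;
  ch_inv : 'rV[R]_m -> T;
  ch_open_dom : open ch_dom;
  ch_open_img : open (ch_map @` ch_dom);
  ch_mapK : forall p, ch_dom p -> ch_inv (ch_map p) = p;
  ch_map_cont : forall p, ch_dom p -> {for p, continuous ch_map};
  ch_inv_cont : forall x, (ch_map @` ch_dom) x -> {for x, continuous ch_inv} }.

(* A smooth m-manifold: an atlas (not required to be maximal) together with a
   preferred chart of the atlas around each point. *)
Record smoothManifold (R : realType) (m : nat) := SmoothManifold {
  mf_space :> topologicalType;
  mf_hausdorff : hausdorff_space mf_space;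
  mf_second_countable : @second_countable mf_space;
  mf_atlas : set (chart R m mf_space);
  mf_compat : forall c c', mf_atlas c -> mf_atlas c' ->
    smooth (ch_map c @` (ch_dom c `&` ch_dom c')) (ch_map c' \o ch_inv c);
  mf_chart : mf_space -> chart R m mf_space;
  mf_chart_atlas : forall p, mf_atlas (mf_chart p);
  mf_chart_dom : forall p, ch_dom (mf_chart p) p }.

(* Tangent vectors: T_pM is represented by ['rV[R]_m], the vector [v] standing
   for the one whose coordinates in the preferred chart at [p] are [v].  A
   vector field is a function [X : M -> 'rV[R]_m] with [X p] read in T_pM; its
   coordinates in an arbitrary chart [c] are [mderiv (ch_map c) p (X p)]. *)
Section Manifold.
Context {R : realType} {m : nat} {M : smoothManifold R m}.

Definition mderiv {V : normedModType R} (F : M -> V) (p : M) (v : 'rV[R]_m) : V :=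
  'D_v (F \o ch_inv (mf_chart p)) (ch_map (mf_chart p) p).

Definition smooth_fun {V : normedModType R} (O : set M) (F : M -> V) : Prop :=
  forall c, mf_atlas c -> smooth (ch_map c @` (ch_dom c `&` O)) (F \o ch_inv c).

Definition smooth_field (O : set M) (X : M -> 'rV[R]_m) : Prop :=
  forall c, mf_atlas c ->
    smooth_fun (O `&` ch_dom c) (fun q => mderiv (ch_map c) q (X q)).

(* [X, Y]^i = X^j d_j Y^i - Y^j d_j X^i in the preferred chart at [p]. *)
Definition lie (X Y : M -> 'rV[R]_m) (p : M) : 'rV[R]_m :=
  let c := ch_map (mf_chart p) in
  mderiv (fun q => mderiv c q (Y q)) p (X p)
  - mderiv (fun q => mderiv c q (X q)) p (Y p).

End Manifold.

Section Maps.
Context {R : realType} {m k : nat} {M : smoothManifold R m}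
        {M' : smoothManifold R k}.

Definition tmap (F : M -> M') (p : M) (v : 'rV[R]_m) : 'rV[R]_k :=
  mderiv (ch_map (mf_chart (F p)) \o F) p v.

Definition smooth_map (F : M -> M') : Prop :=
  continuous F /\
  forall c', mf_atlas c' -> smooth_fun (F @^-1` ch_dom c') (ch_map c' \o F).

Record smooth_embedding (F : M -> M') : Prop := SmoothEmbedding {
  emb_smooth : smooth_map F;
  emb_immersion : forall p, injective (tmap F p);
  emb_inj : injective F;
  emb_homeo : forall p (A : set M), nbhs p A ->
    exists2 B : set M', nbhs (F p) B & F @^-1` B `<=` A }.

End Maps.

(* The i-th vector of the global frame at [p] is [row i (wz_frame p)]. *)
Record weitzenbock (R : realType) (m : nat) := Weitzenbock {
  wz_mf :> smoothManifold R m;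
  wz_frame : wz_mf -> 'M[R]_m;
  wz_frame_smooth : forall i, smooth_field setT (fun p => row i (wz_frame p));
  wz_frame_basis : forall p, wz_frame p \in unitmx }.

Section Weitzenbock.
Context {R : realType} {m : nat} {Mt : weitzenbock R m}.
Implicit Types X Y Z : Mt -> 'rV[R]_m.

(* Coefficients relative to the frame. *)
Definition coef (p : Mt) (v : 'rV[R]_m) : 'rV[R]_m := v *m invmx (wz_frame p).

Definition wz_metric (p : Mt) (u v : 'rV[R]_m) : R := dot (coef p u) (coef p v).

(* The connection with parallel frame, for a section [Y] of TMt along a map
   [F : M -> Mt] (take [F = id] for vector fields on Mt):
   nabla_v (Y^j E_j) = v(Y^j) E_j. *)
Definition wz_conn {k : nat} {M : smoothManifold R k} (F : M -> Mt)
    (Y : M -> 'rV[R]_m) (p : M) (v : 'rV[R]_k) : 'rV[R]_m :=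
  mderiv (fun q => coef (F q) (Y q)) p v *m wz_frame (F p).

Definition wz_nabla X Y (p : Mt) : 'rV[R]_m := wz_conn id Y p (X p).

Definition torsion X Y (p : Mt) : 'rV[R]_m :=
  wz_nabla X Y p - wz_nabla Y X p - lie X Y p.

End Weitzenbock.

Definition parallel_torsion {R : realType} {m : nat} (Mt : weitzenbock R m) : Prop :=
  forall X Y Z : Mt -> 'rV[R]_m,
    smooth_field setT X -> smooth_field setT Y -> smooth_field setT Z ->
    forall p, wz_nabla Z (torsion X Y) p - torsion (wz_nabla Z X) Y p
              - torsion X (wz_nabla Z Y) p = 0.

Definition skew_torsion {R : realType} {m : nat} (Mt : weitzenbock R m) : Prop :=
  forall X Y Z : Mt -> 'rV[R]_m,
    smooth_field setT X -> smooth_field setT Y -> smooth_field setT Z ->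
    X = Y \/ Y = Z \/ X = Z ->
    forall p, wz_metric p (X p) (torsion Y Z p) = 0.

(* An orientation tells which bases of T_pM (the rows of an invertible matrix)
   are oriented: two bases are alike iff their change of basis has positive
   determinant, and the choice is locally constant along smooth local frames.
   In dimension 0 it is an arbitrary sign at each point. *)
Record orientation {R : realType} {m : nat} (M : smoothManifold R m)
    (o : M -> 'M[R]_m -> Prop) : Prop := Orientation {
  or_basis : forall p B B', B \in unitmx -> B' \in unitmx ->
    (o p B <-> o p B') <-> 0 < \det (B' *m invmx B);
  or_locally_const : forall p, exists (O : set M) (E : M -> 'M[R]_m),
    [/\ open O, O p, (forall i, smooth_field O (fun q => row i (E q))),
        (forall q, O q -> E q \in unitmx) &
        (forall q, O q -> o q (E q)) \/ (forall q, O q -> ~ o q (E q))] }.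

Record hypersurface (R : realType) (n : nat) (Mt : weitzenbock R n.+1) :=
  Hypersurface {
    hs_mf :> smoothManifold R n;
    hs_inc : hs_mf -> Mt;
    hs_embedding : smooth_embedding hs_inc;
    hs_oriented : hs_mf -> 'M[R]_n -> Prop;
    hs_orientation : orientation hs_oriented }.

Section Hypersurface.
Context {R : realType} {n : nat} {Mt : weitzenbock R n.+1} {M : hypersurface Mt}.
Notation inc := (@hs_inc R n Mt M).

(* The identification: [phi p v] consists of the frame coefficients of the
   vector [v] of T_pM, regarded in T_pMt. *)
Definition phi (p : M) (v : 'rV[R]_n) : 'rV[R]_n.+1 := coef (inc p) (tmap inc p v).

Definition phi_inv (p : M) (w : 'rV[R]_n.+1) : 'rV[R]_n :=
  xget 0 [set v | phi p v = w].

Definition hs_metric (p : M) (u v : 'rV[R]_n) : R :=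
  wz_metric (inc p) (tmap inc p u) (tmap inc p v).

(* Orthogonal projection T_pMt -> T_pM. *)
Definition tangential (p : M) (w : 'rV[R]_n.+1) : 'rV[R]_n :=
  xget 0 [set v | forall u, hs_metric p v u = wz_metric (inc p) w (tmap inc p u)].

(* Derivative in Mt, along [x] in T_pM, of the vector field [Y] on M. *)
Definition amb_nabla (Y : M -> 'rV[R]_n) (p : M) (x : 'rV[R]_n) : 'rV[R]_n.+1 :=
  wz_conn inc (fun q => tmap inc q (Y q)) p x.

Definition hs_nabla (Y : M -> 'rV[R]_n) (p : M) (x : 'rV[R]_n) : 'rV[R]_n :=
  tangential p (amb_nabla Y p x).

(* [row i B] being the i-th vector of a basis of T_pM, [col_mx] below is the
   matrix of (N, B_1, ..., B_n) relative to the oriented frame of Mt. *)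
Record unit_normal (N : M -> 'rV[R]_n.+1) : Prop := UnitNormal {
  un_smooth : smooth_fun setT (fun p => coef (inc p) (N p));
  un_unit : forall p, wz_metric (inc p) (N p) (N p) = 1;
  un_normal : forall p v, wz_metric (inc p) (N p) (tmap inc p v) = 0;
  un_oriented : forall p (B : 'M[R]_n), B \in unitmx ->
    hs_oriented p B <->
    0 < \det (col_mx (coef (inc p) (N p)) (\matrix_i phi p (row i B)) : 'M[R]_(1 + n)) }.

(* The Weingarten map, as the matrix acting on row vectors: W x = x *m W. *)
Definition weingarten (N : M -> 'rV[R]_n.+1) (p : M) : 'M[R]_n :=
  xget 0 [set W | forall (x : 'rV[R]_n) (O : set M) (Y : M -> 'rV[R]_n),
    open O -> O p -> smooth_field O Y ->
    hs_metric p (x *m W) (Y p) = wz_metric (inc p) (N p) (amb_nabla Y p x)].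

Definition mean_curvature (N : M -> 'rV[R]_n.+1) (p : M) : R :=
  \tr (weingarten N p).

Definition grad (f : M -> R) (p : M) : 'rV[R]_n :=
  xget 0 [set v | forall u, hs_metric p v u = mderiv f p u].

Definition gauss_map (N : M -> 'rV[R]_n.+1) (p : M) : 'rV[R]_n.+1 :=
  coef (inc p) (N p).

Definition local_onframe (p : M) (E : 'I_n -> M -> 'rV[R]_n) : Prop :=
  exists O : set M, [/\ open O, O p, forall i, smooth_field O (E i) &
    forall q, O q -> forall i j, hs_metric q (E i q) (E j q) = (i == j)%:R].

End Hypersurface.

(* The unit sphere of R^m, with T_yS the orthogonal complement of y.  Functions
   and fields on S are restrictions of maps smooth in a neighbourhood of S. *)
Section Sphere.
Context {R : realType} {m : nat}.

Definition sphere : set 'rV[R]_m := [set y | dot y y = 1].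

Definition sphere_smooth {V : normedModType R} (f : 'rV[R]_m -> V) : Prop :=
  exists U : set 'rV[R]_m, [/\ open U, sphere `<=` U & smooth U f].

Definition sphere_field (Y : 'rV[R]_m -> 'rV[R]_m) : Prop :=
  sphere_smooth Y /\ forall y, sphere y -> dot y (Y y) = 0.

(* [D y v Y] is the derivative at y of the field Y along the vector v of T_yS. *)
Record sphere_connection
    (D : 'rV[R]_m -> 'rV[R]_m -> ('rV[R]_m -> 'rV[R]_m) -> 'rV[R]_m) : Prop := {
  sc_ext : forall y v Y Y', sphere y -> dot y v = 0 ->
    sphere_field Y -> sphere_field Y' -> {in sphere, Y =1 Y'} ->
    D y v Y = D y v Y';
  sc_smooth : forall X Y, sphere_field X -> sphere_field Y ->
    exists2 Z, sphere_field Z & {in sphere, forall y, D y (X y) Y = Z y};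
  sc_linear : forall y (a : R) v w Y, sphere y -> dot y v = 0 -> dot y w = 0 ->
    sphere_field Y -> D y (a *: v + w) Y = a *: D y v Y + D y w Y;
  sc_add : forall y v Y Y', sphere y -> dot y v = 0 ->
    sphere_field Y -> sphere_field Y' ->
    D y v (fun z => Y z + Y' z) = D y v Y + D y v Y';
  sc_leibniz : forall y v (f : 'rV[R]_m -> R) Y, sphere y -> dot y v = 0 ->
    sphere_smooth f -> sphere_field Y ->
    D y v (fun z => f z *: Y z) = 'D_v f y *: Y y + f y *: D y v Y }.

(* The Lie bracket of fields on S is D_X Y - D_Y X for the flat derivative. *)
Record levi_civita_sphere
    (D : 'rV[R]_m -> 'rV[R]_m -> ('rV[R]_m -> 'rV[R]_m) -> 'rV[R]_m) : Prop := {
  lc_connection : sphere_connection D;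
  lc_torsion_free : forall y X Y, sphere y -> sphere_field X -> sphere_field Y ->
    D y (X y) Y - D y (Y y) X = 'D_(X y) Y y - 'D_(Y y) X y;
  lc_metric : forall y v Y Z, sphere y -> dot y v = 0 ->
    sphere_field Y -> sphere_field Z ->
    'D_v (fun z => dot (Y z) (Z z)) y = dot (D y v Y) (Z y) + dot (Y y) (D y v Z) }.

Context {k : nat} {M : smoothManifold R k}.

(* Sections over O of g^*TS. *)
Definition pullback_section (g : M -> 'rV[R]_m) (O : set M) (s : M -> 'rV[R]_m) :=
  smooth_fun O s /\ forall q, O q -> dot (g q) (s q) = 0.

(* The connection P = g^*D on g^*TS, [P p v s] being the derivative at p of the
   local section s along v in T_pM.  It is the unique connection satisfying
   P_v (Y o g) = D_{dg(v)} Y for the fields Y on S. *)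
Record pullback_connection
    (D : 'rV[R]_m -> 'rV[R]_m -> ('rV[R]_m -> 'rV[R]_m) -> 'rV[R]_m)
    (g : M -> 'rV[R]_m)
    (P : M -> 'rV[R]_k -> (M -> 'rV[R]_m) -> 'rV[R]_m) : Prop := {
  pc_smooth : forall (O : set M) X s, open O -> smooth_field O X ->
    pullback_section g O s -> pullback_section g O (fun q => P q (X q) s);
  pc_linear : forall (O : set M) p (a : R) v w s, open O -> O p ->
    pullback_section g O s -> P p (a *: v + w) s = a *: P p v s + P p w s;
  pc_add : forall (O : set M) p v s s', open O -> O p ->
    pullback_section g O s -> pullback_section g O s' ->
    P p v (fun q => s q + s' q) = P p v s + P p v s';
  pc_leibniz : forall (O : set M) p v (f : M -> R) s, open O -> O p ->
    smooth_fun O f -> pullback_section g O s ->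
    P p v (fun q => f q *: s q) = mderiv f p v *: s p + f p *: P p v s;
  pc_pullback : forall p v Y, sphere_field Y ->
    P p v (Y \o g) = D (g p) (mderiv g p v) Y }.

End Sphere.

Section Harmonic.
Context {R : realType} {n : nat} {Mt : weitzenbock R n.+1} {M : hypersurface Mt}.

(* [P] stands for the connection g^*nabla^S; the value does not depend on the
   local orthonormal frame chosen. *)
Definition tension_field (P : M -> 'rV[R]_n -> (M -> 'rV[R]_n.+1) -> 'rV[R]_n.+1)
    (g : M -> 'rV[R]_n.+1) (p : M) : 'rV[R]_n.+1 :=
  xget 0 [set w | exists2 E, local_onframe p E &
    w = \sum_i (P p (E i p) (fun q => mderiv g q (E i q))
                - mderiv g p (hs_nabla (E i) p (E i p)))].

Definition harmonic_map (P : M -> 'rV[R]_n -> (M -> 'rV[R]_n.+1) -> 'rV[R]_n.+1)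
    (g : M -> 'rV[R]_n.+1) : Prop :=
  forall p, tension_field P g p = 0.

End Harmonic.

(* Main.v *)
Require Import Defs.
From HB Require Import structures.
From mathcomp Require Import all_boot all_order all_algebra.
From mathcomp Require Import all_classical all_reals all_analysis.
From mathcomp Require Import ring lra.

Set Implicit Arguments.
Unset Strict Implicit.
Unset Printing Implicit Defensive.

Import Order.TTheory GRing.Theory Num.Theory.
Import numFieldNormedType.Exports.

Local Open Scope classical_set_scope.
Local Open Scope ring_scope.

(** Through the global frame, every tangent vector of the ambient manifold is a
vector of a fixed Euclidean space, and the ambient connection is the flat
derivative of these coefficients. Write [g] for the Gauss map, [w X] for the
coefficients [phi X] of a tangent field [X], and let [L] be the matrix-valued
function on the hypersurface with [w X *m L = dg X] and [g *m L = 0]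
([gauss_mx]). Differentiating [<g, w Y> = 0] shows that [L], acting on rows, is
minus the Weingarten map extended by zero to the normal line
([weingarten_phi]), so the mean curvature is [- tr L] ([mean_curvatureE]).

The Levi-Civita connection of the sphere is the tangential part of the flat
derivative. By a Koszul argument this holds for the projections of constant
fields ([levi_civita_tangent_proj]), and these span, so the pullback connection
is the projected flat derivative as well ([pullback_sphereE]). Hence, in an
orthonormal frame [E i] with [e i = w (E i)], the product rule cancels all
derivatives of the frame, and the tension field is the tangential part of the
sum of [e i *m D_i L], where [D_i] is the derivative along [E i]
([tension_summand]). It remains to see that its inner product with [e j] is
[tr (D_j L)], the derivative of minus the mean curvature.

Two identities do this. Cartan's structure equation
[D_X (w Y) - D_Y (w X) - w [X, Y] = T (w X, w Y)] ([structure_equation]) and the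
commutation of second derivatives of [g] give the Codazzi equation
[e i *m D_j L = e j *m D_i L + T (e i, e j) *m L] ([gauss_mx_codazzi]). Pairing the
structure equation with the normal shows that the skew part of [L] is given by
[<g, T (u, v)>] ([gauss_mx_skew]). Parallel torsion means constant coefficients of
[T] ([parallel_frame_torsion]), so differentiating this identity produces a term
in the derivative of [g] only ([gauss_mx_skew_derive]). Both identities exchange
indices up to a torsion term; with [K b = T (e j, b)], a skew matrix since the
torsion is totally skew, the two terms are [tr (K L)] and [tr (L K)], and they
cancel ([divergence_trace]).

Orthonormal frames exist locally ([exists_local_onframe]), so the tension field
is identified everywhere ([tension_fieldP]). It vanishes exactly where the
differential of the mean curvature does ([tension_eq0]), and on a connected
hypersurface a smooth function with zero differential is constant. *)

(** * Differentiation of vector- and matrix-valued maps *)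

Section Differentiation.
Context {R : realType}.
Implicit Types (V W : normedModType R).

Lemma near_eq_differentiable V W (f g : V -> W) (x : V) :
  (\near x, f x = g x) -> differentiable f x -> differentiable g x.
Proof.
move=> fg df; have fgx := nbhs_singleton fg.
have dg : g \o shift x = cst (g x) + 'd f x +o_ 0 id.
  apply/eqaddoP => _/posnumP[e].
  have /eqaddoP/(_ _ [gt0 of e%:num]) := diff_locally df.
  have : \forall h \near 0, f (h + x) = g (h + x).
    by move: fg; rewrite (near_shift 0) /= subr0.
  apply: filterS2 => h fgh; rewrite -fgx /=.
  by rewrite !fctE /= fgh.
apply/diff_locallyP; rewrite (diff_unique (diff_continuous df) dg).
by split=> //; exact: diff_continuous.
Qed.

Lemma derive_comp V V' W (f : V -> V') (g : V' -> W) (x v : V) :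
  differentiable f x -> differentiable g (f x) ->
  'D_v (g \o f) x = 'D_('D_v f x) g (f x).
Proof.
move=> df dg; rewrite !deriveE //; last exact: differentiable_comp.
by rewrite diff_comp.
Qed.

Lemma derive_linear V W (f : V -> W) (x : V) (a : R) (v w : V) :
  differentiable f x -> 'D_(a *: v + w) f x = a *: 'D_v f x + 'D_w f x.
Proof. by move=> df; rewrite !deriveE // linearP. Qed.

Lemma differentiable_mxP V m n (M : V -> 'M[R]_(m, n)) (x : V) :
  differentiable M x <-> forall i j, differentiable (fun y => M y i j) x.
Proof.
split=> [dM i j|dM].
  exact: (differentiable_comp (f := M) (g := fun N : 'M[R]_(m, n) => N i j))
    dM (differentiable_coord _ _ _).
rewrite (_ : M = \sum_(i < m) \sum_(j < n) (fun y => M y i j *: delta_mx i j)).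
  apply: differentiable_sum => i; apply: differentiable_sum => j.
  exact: differentiableZl.
apply/funext => y; rewrite fct_sumE [LHS]matrix_sum_delta.
by apply: eq_bigr => i _; rewrite fct_sumE.
Qed.

Lemma derive_entry V m n (M : V -> 'M[R]_(m, n)) (x v : V) i j :
  differentiable M x -> ('D_v M x) i j = 'D_v (fun y => M y i j) x.
Proof. by move=> dM; rewrite derive_mx ?mxE //; exact: diff_derivable. Qed.

Lemma derive_row_sum W m (f : 'rV[R]_m -> W) (x v : 'rV[R]_m) :
  differentiable f x ->
  'D_v f x = \sum_j v 0 j *: 'D_(delta_mx 0 j) f x.
Proof.
move=> df; rewrite deriveE // [in LHS](row_sum_delta v) linear_sum.
by apply: eq_bigr => j _; rewrite linearZ deriveE.
Qed.

End Differentiation.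

(** * Maps of class C^k *)

Section Smoothness.
Context {R : realType}.
Implicit Types (V W : normedModType R).

(** [Ck] quantifies over the points of [U] at every order, so it makes sense on
    the singletons of a set that is not open. This is how a function is replaced
    by one that agrees with it near a point only. *)
Lemma Ck_ptwise V W k (U : set V) (f : V -> W) :
  Ck k U f <-> forall x, U x -> Ck k [set x] f.
Proof.
elim: k f => [|k IH] f /=.
  by split=> [h x Ux y ->|h x Ux]; [exact: h|exact: (h _ Ux)].
split=> [[df h] x Ux|h].
  split=> [y ->|v]; first exact: df.
  by have /IH := h v; exact.
split=> [x Ux|v]; first by have [df _] := h x Ux; exact: df.
by apply/IH => x Ux; have [_] := h x Ux; exact.
Qed.

Lemma Ck_subset V W k (U U' : set V) (f : V -> W) :
  U `<=` U' -> Ck k U' f -> Ck k U f.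
Proof. by move=> sUU' /Ck_ptwise h; apply/Ck_ptwise => x /sUU'; exact: h. Qed.

Lemma CkS V W k (U : set V) (f : V -> W) : Ck k.+1 U f -> Ck k U f.
Proof.
elim: k f => [|k IH] f [df h].
  by move=> x /df; exact: differentiable_continuous.
by split=> // v; exact/IH/h.
Qed.

Lemma Ck_near_eq V W k (x : V) (f g : V -> W) :
  (\near x, f x = g x) -> Ck k [set x] f -> Ck k [set x] g.
Proof.
elim: k f g => [|k IH] f g fg.
  move=> h y -> /=; have := h x erefl.
  rewrite /prop_for /continuous_at -(nbhs_singleton fg); apply: cvg_trans.
  by apply: near_eq_cvg; apply: filterS fg.
case=> df h; split=> [y ->|v].
  exact: (near_eq_differentiable fg (df x erefl)).
apply: IH (h v); apply: filterS (nbhs_interior fg) => y; exact: near_eq_derive.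
Qed.

Lemma Ck_eq_open V W k (U : set V) (f g : V -> W) : open U ->
  (forall x, U x -> f x = g x) -> Ck k U f -> Ck k U g.
Proof.
move=> Uo fg /Ck_ptwise h; apply/Ck_ptwise => x Ux.
apply: Ck_near_eq (h x Ux).
by apply: filterS (open_nbhs_nbhs (conj Uo Ux)).
Qed.

Lemma Ck_cst V W k (U : set V) (a : W) : Ck k U (fun=> a).
Proof.
elim: k a => [|k IH] a; first by move=> x _; exact: cst_continuous.
split=> [x _|v]; first exact: differentiable_cst.
have -> : (fun x => 'D_v (fun=> a) x) = (fun=> 0 : W); last exact: IH.
by apply/funext => x; exact: derive_cst.
Qed.

Lemma CkD V W k (U : set V) (f g : V -> W) : open U ->
  Ck k U f -> Ck k U g -> Ck k U (fun x => f x + g x).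
Proof.
move=> Uo; elim: k f g => [|k IH] f g.
  by move=> cf cg x Ux; apply: cvgD; [exact: cf|exact: cg].
move=> [df cf] [dg cg]; split=> [x Ux|v].
  by apply: differentiableD; [exact: df|exact: dg].
apply: Ck_eq_open Uo _ (IH _ _ (cf v) (cg v)) => x Ux.
by rewrite deriveD //; apply: diff_derivable; [exact: df|exact: dg].
Qed.

Lemma Ck_sum V W k (U : set V) (I : Type) (r : seq I) (P : pred I)
    (f : I -> V -> W) : open U ->
  (forall i, Ck k U (f i)) -> Ck k U (fun x => \sum_(i <- r | P i) f i x).
Proof.
move=> Uo cf; elim: r => [|i r IH].
  have -> : (fun x => \sum_(i <- [::] | P i) f i x) = (fun=> 0 : W);
    last exact: Ck_cst.
  by apply/funext => x; rewrite big_nil.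
under eq_fun do rewrite big_cons.
by case: (P i) => //; exact: CkD.
Qed.

Lemma CkM V k (U : set V) (f g : V -> R) : open U ->
  Ck k U f -> Ck k U g -> Ck k U (fun x => f x * g x).
Proof.
move=> Uo; elim: k f g => [|k IH] f g.
  by move=> cf cg x Ux; apply: cvgM; [exact: cf|exact: cg].
move=> Cf Cg; have [df cf] := Cf; have [dg cg] := Cg; split=> [x Ux|v].
  by apply: differentiableM; [exact: df|exact: dg].
apply: Ck_eq_open Uo _ (CkD Uo (IH _ _ (CkS Cf) (cg v)) (IH _ _ (CkS Cg) (cf v))).
by move=> x Ux; rewrite deriveM //; apply: diff_derivable; [exact: df|exact: dg].
Qed.

Lemma Ck_prod V k (U : set V) (I : Type) (r : seq I) (P : pred I)
    (f : I -> V -> R) : open U ->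
  (forall i, Ck k U (f i)) -> Ck k U (fun x => \prod_(i <- r | P i) f i x).
Proof.
move=> Uo cf; elim: r => [|i r IH].
  have -> : (fun x => \prod_(i <- [::] | P i) f i x) = (fun=> 1 : R);
    last exact: Ck_cst.
  by apply/funext => x; rewrite big_nil.
under eq_fun do rewrite big_cons.
by case: (P i) => //; exact: CkM.
Qed.

Lemma CkN V k (U : set V) (f : V -> R) : open U ->
  Ck k U f -> Ck k U (fun x => - f x).
Proof.
move=> Uo cf; under eq_fun do rewrite -mulN1r.
by apply: CkM => //; exact: Ck_cst.
Qed.

Lemma CkV V k (U : set V) (f : V -> R) : open U ->
  (forall x, U x -> f x != 0) -> Ck k U f -> Ck k U (fun x => (f x)^-1).
Proof.
move=> Uo f0; elim: k f f0 => [|k IH] f f0.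
  by move=> cf x Ux; apply: cvgV; [exact: f0|exact: cf].
move=> Cf; have [df cf] := Cf; split=> [x Ux|v].
  by apply: differentiableV; [exact: df|exact: f0].
have CV := IH f f0 (CkS Cf).
apply: Ck_eq_open Uo _ (CkN Uo (CkM Uo (CkM Uo CV CV) (cf v))) => x Ux.
rewrite deriveV ?f0 //; last by apply: diff_derivable; exact: df.
by rewrite /GRing.scale /= -expr2 -exprVn mulNr.
Qed.

Lemma Ck_mxP V k m n (U : set V) (M : V -> 'M[R]_(m, n)) : open U ->
  Ck k U M <-> forall i j, Ck k U (fun x => M x i j).
Proof.
move=> Uo; elim: k M => [|k IH] M.
  split=> [h i j x Ux|h x Ux].
    apply: (@continuous_comp _ _ _ M (fun N : 'M[R]_(m, n) => N i j)).
      exact: h.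
    exact: coord_continuous.
  apply/cvgrPdist_le => /= e e0; near=> y.
  rewrite /Num.Def.normr /= mx_normrE (bigmax_le _ (ltW e0)) //= => i _.
  rewrite !mxE; move: i; near: y; apply: filter_forall => /= i.
  by have /cvgrPdist_le := h i.1 i.2 x Ux; apply.
split=> [[dM cM] i j|h].
  split=> [x Ux|v]; first by have /differentiable_mxP := dM x Ux; exact.
  have /IH/(_ i j) := cM v; apply: Ck_eq_open Uo _ => x Ux.
  by rewrite derive_entry //; exact: dM.
have dM x : U x -> differentiable M x.
  by move=> Ux; apply/differentiable_mxP => i j; have [+ _] := h i j; exact.
split=> // v; apply/IH => i j; have [_ /(_ v)] := h i j.
by apply: Ck_eq_open Uo _ => x Ux; rewrite derive_entry //; exact: dM.
Unshelve. all: by end_near. Qed.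

(** By the chain rule a directional derivative of [g \o f] is a combination of
    the partial derivatives of [g], composed with [f], and the induction
    hypothesis applies to these. *)
Lemma Ck_comp V k m (U : set V) (U' : set 'rV[R]_m) (f : V -> 'rV[R]_m)
    (g : 'rV[R]_m -> R) : open U -> (forall x, U x -> U' (f x)) ->
  Ck k U f -> Ck k U' g -> Ck k U (g \o f).
Proof.
move=> Uo fU; elim: k g => [|k IH] g.
  move=> cf cg x Ux; apply: continuous_comp; first exact: cf.
  exact/cg/fU.
move=> Cf [dg cg]; have [df cf] := Cf; split=> [x Ux|v].
  by apply: differentiable_comp; [exact: df|exact/dg/fU].
pose h x := \sum_j ('D_v f x) 0 j * ('D_(delta_mx 0 j) g \o f) x.
apply: (@Ck_eq_open _ _ _ _ h) => //.
  move=> x Ux; rewrite derive_comp; [|exact: df|exact/dg/fU].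
  by rewrite derive_row_sum //; exact/dg/fU.
apply: Ck_sum => // j; apply: CkM => //.
  by have /(Ck_mxP _ _ Uo)/(_ 0 j) := cf v.
by apply: IH; [exact: CkS|exact: cg].
Qed.

Lemma Ck_comp_mx V k m p q (U : set V) (U' : set 'rV[R]_m) (f : V -> 'rV[R]_m)
    (g : 'rV[R]_m -> 'M[R]_(p, q)) : open U -> open U' ->
  (forall x, U x -> U' (f x)) ->
  Ck k U f -> Ck k U' g -> Ck k U (g \o f).
Proof.
move=> Uo Uo' fU Cf /(Ck_mxP _ _ Uo') Cg; apply/(Ck_mxP _ _ Uo) => i j.
exact: (Ck_comp Uo fU Cf (Cg i j)).
Qed.

Lemma Ck_mulmx V k m n p (U : set V) (A : V -> 'M[R]_(m, n))
    (B : V -> 'M[R]_(n, p)) : open U ->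
  Ck k U A -> Ck k U B -> Ck k U (fun x => A x *m B x).
Proof.
move=> Uo /(Ck_mxP _ _ Uo) CA /(Ck_mxP _ _ Uo) CB; apply/(Ck_mxP _ _ Uo) => i j.
under eq_fun do rewrite mxE.
by apply: Ck_sum => // l; exact: CkM.
Qed.

Lemma Ck_det V k n (U : set V) (A : V -> 'M[R]_n) : open U ->
  (forall i j, Ck k U (fun x => A x i j)) -> Ck k U (fun x => \det (A x)).
Proof.
move=> Uo CA; apply: Ck_sum => // s.
by apply: CkM => //; [exact: Ck_cst|exact: Ck_prod].
Qed.

(** Cramer's rule makes the entries of the inverse quotients of polynomials in
    the entries. *)
Lemma Ck_invmx V k n (U : set V) (A : V -> 'M[R]_n) : open U ->
  (forall x, U x -> A x \in unitmx) -> Ck k U A ->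
  Ck k U (fun x => invmx (A x)).
Proof.
move=> Uo uA /(Ck_mxP _ _ Uo) CA; apply/(Ck_mxP _ _ Uo) => i j.
apply: (@Ck_eq_open _ _ _ _ (fun x => (\det (A x))^-1 * cofactor (A x) j i)) => //.
  by move=> x Ux; rewrite /invmx uA // !mxE.
apply: CkM => //.
  apply: CkV => //; last exact: Ck_det.
  by move=> x Ux; have := uA x Ux; rewrite unitmxE unitfE.
apply: CkM => //; first exact: Ck_cst.
by apply: Ck_det => // a b; under eq_fun do rewrite !mxE; exact: CA.
Qed.

End Smoothness.

(** * Product rules and the mean value theorem *)

Section SmoothnessExtra.
Context {R : realType}.
Implicit Types (V W : normedModType R).

Lemma Ck_id V k (U : set V) : Ck k U (fun x => x).
Proof.
case: k => [|k]; first by move=> x _; exact: cvg_id.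
split=> [x _|v]; first exact: ex_diff.
have -> : (fun x => 'D_v (fun x => x) x) = (fun=> v); last exact: Ck_cst.
by apply/funext => x; exact: derive_id.
Qed.

Lemma Ck_scalemx V k m n (U : set V) (f : V -> R) (A : V -> 'M[R]_(m, n)) :
  open U -> Ck k U f -> Ck k U A -> Ck k U (fun x => f x *: A x).
Proof.
move=> Uo Cf /(Ck_mxP _ _ Uo) CA; apply/(Ck_mxP _ _ Uo) => i j.
by under eq_fun do rewrite mxE; exact: CkM.
Qed.

Lemma derive_mulmx V m n p (A : V -> 'M[R]_(m, n)) (B : V -> 'M[R]_(n, p))
    (x v : V) : differentiable A x -> differentiable B x ->
  'D_v (fun y => A y *m B y) x = 'D_v A x *m B x + A x *m 'D_v B x.
Proof.
move=> dA dB.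
have dAe i j : differentiable (fun y => A y i j) x by move/differentiable_mxP: dA.
have dBe i j : differentiable (fun y => B y i j) x by move/differentiable_mxP: dB.
have dAB i j : (fun y => (A y *m B y) i j) =
    \sum_l ((fun y => A y i l) * (fun y => B y l j)).
  by apply/funext => y; rewrite mxE fct_sumE.
apply/matrixP => i j; rewrite derive_entry; last first.
  apply/differentiable_mxP => a b; rewrite dAB.
  by apply: differentiable_sum => l; exact: differentiableM.
rewrite dAB derive_sum => [|l]; last first.
  by apply/diff_derivable/differentiableM.
rewrite !mxE -big_split; apply: eq_bigr => l _ /=.
rewrite deriveM; [|exact: diff_derivable..].
by rewrite !derive_entry // addrC; congr (_ + _); exact: mulrC.
Qed.

Lemma differentiable_mulmx V m n p (A : V -> 'M[R]_(m, n))
    (B : V -> 'M[R]_(n, p)) (x : V) :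
  differentiable A x -> differentiable B x ->
  differentiable (fun y => A y *m B y) x.
Proof.
move=> /differentiable_mxP dA /differentiable_mxP dB.
apply/differentiable_mxP => i j.
have -> : (fun y => (A y *m B y) i j) =
    \sum_l ((fun y => A y i l) * (fun y => B y l j)).
  by apply/funext => y; rewrite mxE fct_sumE.
by apply: differentiable_sum => l; exact: differentiableM.
Qed.

Lemma derive_mulmxr V m n p (A : V -> 'M[R]_(m, n)) (B : 'M[R]_(n, p))
    (x v : V) : differentiable A x ->
  'D_v (fun y => A y *m B) x = 'D_v A x *m B.
Proof.
move=> dA; have dB : differentiable (fun=> B) x := differentiable_cst B x.
by rewrite (derive_mulmx _ dA dB) derive_cst mulmx0 addr0.
Qed.

Lemma derive_trmx V m n (A : V -> 'M[R]_(m, n)) (x v : V) :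
  differentiable A x -> 'D_v (fun y => (A y)^T) x = ('D_v A x)^T.
Proof.
move=> /[dup] dA /differentiable_mxP dAe; apply/matrixP => i j.
rewrite mxE !derive_entry //.
  by congr ('D_v _ x); apply/funext => y; rewrite mxE.
apply/differentiable_mxP => a b.
by under eq_fun do rewrite mxE.
Qed.

Lemma derive_mxtrace V n (A : V -> 'M[R]_n) (x v : V) :
  differentiable A x -> 'D_v (fun y => \tr (A y)) x = \tr ('D_v A x).
Proof.
move=> /[dup] dA /differentiable_mxP dAe.
have -> : (fun y => \tr (A y)) = \sum_i (fun y => A y i i).
  by apply/funext => y; rewrite fct_sumE.
rewrite derive_sum => [|i]; last exact: diff_derivable.
by apply: eq_bigr => i _; rewrite derive_entry.
Qed.

Lemma differentiable_mxtrace V n (A : V -> 'M[R]_n) (x : V) :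
  differentiable A x -> differentiable (fun y => \tr (A y)) x.
Proof.
move=> /differentiable_mxP dA.
have -> : (fun y => \tr (A y)) = \sum_i (fun y => A y i i).
  by apply/funext => y; rewrite fct_sumE.
exact: differentiable_sum.
Qed.

Lemma is_derive_line V W (f : V -> W) (x u : V) (t : R) :
  differentiable f (x + t *: u) ->
  is_derive t 1 (fun s => f (x + s *: u)) ('D_u f (x + t *: u)).
Proof.
move=> df.
have dl : differentiable (fun s : R => x + s *: u) t.
  by apply: differentiableD => //; exact: differentiable_cst.
have -> : (fun s => f (x + s *: u)) = f \o (fun s => x + s *: u) by [].
apply: DeriveDef; first by apply/diff_derivable; exact: differentiable_comp.
rewrite derive_comp //; congr ('D_ _ f _).
rewrite deriveD //; last by apply: diff_derivable.
by rewrite derive_cst add0r deriveE // diff_val scale1r.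
Qed.

Lemma line_MVT V (f : V -> R) (x u : V) (a : R) : 0 < a ->
  (forall t, 0 <= t <= a -> differentiable f (x + t *: u)) ->
  exists2 c, 0 < c < a & f (x + a *: u) - f x = 'D_u f (x + c *: u) * a.
Proof.
move=> a0 df.
have dl t : t \in `[0, a] -> is_derive t 1 (fun s => f (x + s *: u))
    ('D_u f (x + t *: u)).
  by rewrite in_itv => /df; exact: is_derive_line.
have dlo t : t \in `]0, a[ -> is_derive t 1 (fun s => f (x + s *: u))
    ('D_u f (x + t *: u)).
  by move=> tab; apply: dl; exact: subset_itv_oo_cc tab.
have cl : {within `[0, a], continuous (fun s => f (x + s *: u))}.
  apply: derivable_within_continuous => t tab.
  exact: (@ex_derive _ _ _ _ _ _ _ (dl t tab)).
have [c cab E] := MVT a0 dlo cl; exists c; first by move: cab; rewrite in_itv.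
by move: E => /=; rewrite scale0r addr0 subr0.
Qed.

End SmoothnessExtra.

(** * Symmetry of second derivatives *)

Section Schwarz.
Context {R : realType} {V : normedModType R}.

Lemma differentiable_shift (w x : V) : differentiable (fun y : V => y + w) x.
Proof. by apply: differentiableD => //; exact: differentiable_cst. Qed.

Lemma derive_shift (f : V -> R) (w x u : V) : differentiable f (x + w) ->
  'D_u (fun y => f (y + w)) x = 'D_u f (x + w).
Proof.
move=> df; have ds := differentiable_shift w x.
have -> : (fun y => f (y + w)) = f \o (fun y => y + w) by [].
rewrite derive_comp // deriveD ?derive_id ?derive_cst ?addr0 //.
Qed.

Lemma ler_dist_halves (e b c c1 c2 : R) :
  c1 = c2 -> `|c - c1| < e / 2 -> `|b - c2| < e / 2 -> `|b - c| <= 0 + e.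
Proof.
move=> -> cc bc; rewrite add0r (splitr e) (le_trans (ler_distD c2 _ _)) //.
by rewrite lerD ?(ltW bc) // distrC ltW.
Qed.

(** The mean value theorem is used twice: along [u] for the increment
    [y |-> f (y + a *: v) - f y], then along [v] for ['D_u f]. *)
Lemma second_difference (f : V -> R) (U B : set V) (x u v : V) :
  open U -> U x -> Ck 2 U f -> nbhs x B ->
  exists2 d, 0 < d & forall a, 0 < a < d -> exists2 y, B y &
    f (x + a *: u + a *: v) - f (x + a *: u) - (f (x + a *: v) - f x) =
    'D_v (fun z => 'D_u f z) y * a * a.
Proof.
move=> Uo Ux [df Cf] nB.
have /nbhs_ballP [r /= r0 rUB] : nbhs x (U `&` B).
  by apply: filterI nB; exact: open_nbhs_nbhs.
have D0 : 0 < `|u| + `|v| + 1 by rewrite ltr_wpDl // addr_ge0.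
exists (r / (`|u| + `|v| + 1)); first by rewrite divr_gt0.
move=> a /andP[a0]; rewrite ltr_pdivlMr // => ar.
have inUB s t : 0 <= s <= a -> 0 <= t <= a -> (U `&` B) (x + s *: u + t *: v).
  move=> /andP[s0 sa] /andP[t0 ta]; apply: rUB.
  rewrite -ball_normE /= -addrA opprD addNKr normrN.
  apply: le_lt_trans ar; rewrite (le_trans (ler_normD _ _)) // !normrZ.
  rewrite !ger0_norm // !mulrDr mulr1 ler_wpDr ?(ltW a0) //.
  by rewrite lerD // ler_wpM2r.
pose k y := f (y + a *: v) - f y.
have a0a : 0 <= a <= a by rewrite (ltW a0) lexx.
have z0a : (0 : R) <= 0 <= a by rewrite lexx (ltW a0).
have dfs s t : 0 <= s <= a -> 0 <= t <= a ->
    differentiable f (x + s *: u + t *: v).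
  by move=> sa ta; apply: df; have [] := inUB s t sa ta.
have dsh t y : differentiable f (y + t *: v) ->
    differentiable (fun z => f (z + t *: v)) y.
  by move=> dfy; apply: (differentiable_comp (differentiable_shift _ _)).
have dk s : 0 <= s <= a -> differentiable k (x + s *: u).
  move=> sa; apply: differentiableB; first exact/dsh/dfs.
  by have := dfs s 0 sa z0a; rewrite scale0r addr0.
have [c /andP[c0 ca] kE] := line_MVT a0 dk.
have cc : 0 <= c <= a by rewrite !ltW.
have [dDu _] := Cf u.
have dDf t : 0 <= t <= a ->
    differentiable (fun z => 'D_u f z) (x + c *: u + t *: v).
  by move=> ta; apply: dDu; have [] := inUB c t cc ta.
have [e /andP[e0 ea] eE] := line_MVT a0 dDf.
exists (x + c *: u + e *: v).
  by have [] := inUB c e cc (introT andP (conj (ltW e0) (ltW ea))).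
rewrite -[LHS]/(k (x + a *: u) - k x) kE -eE; congr (_ * a).
have dc0 : differentiable f (x + c *: u).
  by have := dfs c 0 cc z0a; rewrite scale0r addr0.
rewrite deriveB; [|exact/diff_derivable/dsh/dfs|exact: diff_derivable].
by rewrite derive_shift //; exact: dfs.
Qed.

(** Both mixed derivatives are limits of the same second difference quotient. *)
Lemma derive_swap (f : V -> R) (U : set V) (x u v : V) :
  open U -> U x -> Ck 2 U f ->
  'D_u (fun y => 'D_v f y) x = 'D_v (fun y => 'D_u f y) x.
Proof.
move=> Uo Ux Cf; apply/eqP; rewrite -subr_eq0 -normr_le0; apply/ler_addgt0Pr => e e0.
have cont w w' : {for x, continuous (fun y => 'D_w (fun z => 'D_w' f z) y)}.
  by have [_ /(_ w') [_ /(_ w)]] := Cf; exact.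
have nb w w' : nbhs x [set y | `|'D_w (fun z => 'D_w' f z) x
    - 'D_w (fun z => 'D_w' f z) y| < e / 2].
  by have /cvgrPdist_lt/(_ (e / 2)) := cont w w'; apply; rewrite divr_gt0.
have [d1 d10 h1] := second_difference u v Uo Ux Cf (nb v u).
have [d2 d20 h2] := second_difference v u Uo Ux Cf (nb u v).
pose a := Num.min d1 d2 / 2.
have m0 : 0 < Num.min d1 d2 by rewrite lt_min d10.
have a0 : 0 < a by rewrite divr_gt0.
have am : a < Num.min d1 d2 by rewrite ltr_pdivrMr // ltr_pMr // ltr1n.
have /andP[ad1 ad2] : (a < d1) && (a < d2) by rewrite -lt_min.
have [|y1 /= y1e E1] := h1 a; first by rewrite a0.
have [|y2 /= y2e E2] := h2 a; first by rewrite a0.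
have E : 'D_v (fun z => 'D_u f z) y1 = 'D_u (fun z => 'D_v f z) y2.
  apply/(mulIf (lt0r_neq0 a0))/(mulIf (lt0r_neq0 a0)).
  apply: etrans (esym E1) (etrans _ E2).
  by rewrite (addrAC x (a *: u)) !opprB !addrA [LHS]addrAC [RHS]addrAC;
  congr (_ + _); exact: addrAC.
exact: ler_dist_halves E y1e y2e.
Qed.

End Schwarz.

Section ZeroDerivative.
Context {R : realType} {V : normedModType R}.

Lemma derive0_locally_const (f : V -> R) (U : set V) (x : V) :
  open U -> U x -> (forall y, U y -> differentiable f y) ->
  (forall y v, U y -> 'D_v f y = 0) -> \forall y \near x, f y = f x.
Proof.
move=> Uo Ux df D0.
have /nbhs_ballP [r /= r0 rU] : nbhs x U by exact: open_nbhs_nbhs.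
apply/nbhs_ballP; exists r => //= y; rewrite -ball_normE /= => xy.
have lU t : 0 <= t <= 1 -> U (x + t *: (y - x)).
  move=> /andP[t0 t1]; apply: rU; rewrite -ball_normE /= opprD addNKr normrN.
  by rewrite normrZ ger0_norm // (le_lt_trans _ xy) // distrC ler_piMl.
have dl t : 0 <= t <= 1 -> differentiable f (x + t *: (y - x)).
  by move=> /lU; exact: df.
have [c /andP[c0 c1]] := line_MVT (@ltr01 R) dl.
rewrite D0 ?mul0r; last by apply: lU; rewrite !ltW.
by rewrite scale1r subrKC => /eqP; rewrite subr_eq0 => /eqP.
Qed.

End ZeroDerivative.

(** * Charts and smooth functions on a manifold *)

Section Charts.
Context {R : realType} {m : nat} {M : smoothManifold R m}.
Implicit Types (c : chart R m M) (W : normedModType R) (O : set M).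

Lemma ch_inv_img c x : (ch_map c @` ch_dom c) x ->
  ch_dom c (ch_inv c x) /\ ch_map c (ch_inv c x) = x.
Proof. by move=> [q cq <-]; rewrite ch_mapK. Qed.

Lemma chart_img_open c O : open O -> open (ch_map c @` (ch_dom c `&` O)).
Proof.
move=> Oo.
have -> : ch_map c @` (ch_dom c `&` O) =
    ch_map c @` ch_dom c `&` ch_inv c @^-1` O.
  apply/seteqP; split=> [x [q [cq Oq] <-]|x [cx Ox]].
    by split; [exists q|rewrite /= ch_mapK].
  by have [ci ciE] := ch_inv_img cx; exists (ch_inv c x).
rewrite openE => x [cx Ox]; apply: filterI.
  by apply: open_nbhs_nbhs; split=> //; exact: ch_open_img.
by apply: (ch_inv_cont cx); exact: open_nbhs_nbhs.
Qed.

Arguments chart_img_open c {O} _.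

Lemma smooth_fun_sub W O O' (F : M -> W) :
  O' `<=` O -> smooth_fun O F -> smooth_fun O' F.
Proof.
move=> sO hF c ac k; apply: Ck_subset (hF c ac k).
by apply: image_subset => q [? /sO].
Qed.

Lemma smooth_fun_ptwise W O (F : M -> W) :
  smooth_fun O F <-> forall q, O q -> smooth_fun [set q] F.
Proof.
split=> [hF q Oq|hF c ac k]; first by apply: smooth_fun_sub hF => ? ->.
apply/Ck_ptwise => x [q [cq Oq] <-]; apply: Ck_subset (hF q Oq c ac k).
by move=> _ ->; exists q.
Qed.

Lemma smooth_fun_near_eq W O O' (F G : M -> W) : open O' -> O `<=` O' ->
  (forall q, O' q -> F q = G q) -> smooth_fun O F -> smooth_fun O G.
Proof.
move=> O'o sO FG hF c ac k; apply/Ck_ptwise => x [q [cq Oq] xE].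
have /Ck_ptwise/(_ x) := hF c ac k; move=> /(_ _)/(Ck_near_eq _); apply.
  have := chart_img_open c O'o.
  rewrite openE => /(_ x) h; have /h : (ch_map c @` (ch_dom c `&` O')) x.
    by exists q => //; split=> //; exact: sO.
  by apply: filterS => _ [r [cr O'r] <-] /=; rewrite ch_mapK ?FG.
by exists q.
Qed.

Lemma smooth_fun_eq W O (F G : M -> W) : open O ->
  (forall q, O q -> F q = G q) -> smooth_fun O F -> smooth_fun O G.
Proof. by move=> Oo; exact: smooth_fun_near_eq. Qed.

Lemma smooth_fun_differentiable W O (F : M -> W) c q : mf_atlas c ->
  smooth_fun O F -> O q -> ch_dom c q ->
  differentiable (F \o ch_inv c) (ch_map c q).
Proof. by move=> ac hF Oq cq; have [+ _] := hF c ac 1; apply; exists q. Qed.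

(** A single chart suffices, since the others are reached through transition
    maps. *)
Lemma smooth_fun_chart p' q' c O (F : M -> 'M[R]_(p', q')) : open O ->
  mf_atlas c -> O `<=` ch_dom c ->
  smooth (ch_map c @` O) (F \o ch_inv c) -> smooth_fun O F.
Proof.
move=> Oo ac Oc hF c' ac' k.
have dO : ch_dom c `&` O = O by apply/seteqP; split=> [q []|q Oq] //; split=> //; exact: Oc.
have Uo := chart_img_open c' Oo; have Uo' := chart_img_open c Oo.
rewrite dO in Uo'.
apply: (@Ck_eq_open _ _ _ _ _ ((F \o ch_inv c) \o (ch_map c \o ch_inv c'))) => //.
  by move=> _ [q [cq Oq] <-] /=; rewrite !ch_mapK //; exact: Oc.
apply: (Ck_comp_mx Uo Uo' _ _ (hF k)).
  by move=> _ [q [cq Oq] <-]; exists q => //=; rewrite ch_mapK.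
apply: Ck_subset (mf_compat ac' ac k).
by apply: image_subset => q [cq Oq]; split=> //; exact: Oc.
Qed.

Lemma smooth_fun_atlas c : mf_atlas c -> smooth_fun (ch_dom c) (ch_map c).
Proof. by move=> ac c' ac'; exact: mf_compat. Qed.

Lemma smooth_fun_mxP p' q' O (F : M -> 'M[R]_(p', q')) : open O ->
  smooth_fun O F <-> forall i j, smooth_fun O (fun q => F q i j).
Proof.
move=> Oo; split=> [hF i j c ac k|hF c ac k].
  by have /(Ck_mxP _ _ (chart_img_open c Oo)) := hF c ac k; exact.
by apply/(Ck_mxP _ _ (chart_img_open c Oo)) => i j; exact: hF.
Qed.

Lemma smooth_fun_cst W O (a : W) : smooth_fun O (fun=> a).
Proof. by move=> c ac k; exact: Ck_cst. Qed.

Lemma smooth_funD W O (F G : M -> W) : open O ->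
  smooth_fun O F -> smooth_fun O G -> smooth_fun O (fun q => F q + G q).
Proof.
by move=> Oo hF hG c ac k; apply: CkD (hF c ac k) (hG c ac k); exact: chart_img_open.
Qed.

Lemma smooth_fun_sum W O (I : Type) (r : seq I) (P : pred I)
    (F : I -> M -> W) : open O -> (forall i, smooth_fun O (F i)) ->
  smooth_fun O (fun q => \sum_(i <- r | P i) F i q).
Proof.
move=> Oo hF c ac k; apply: (Ck_sum r P (chart_img_open c Oo)) => i.
exact: hF.
Qed.

Lemma smooth_funM O (F G : M -> R) : open O ->
  smooth_fun O F -> smooth_fun O G -> smooth_fun O (fun q => F q * G q).
Proof.
by move=> Oo hF hG c ac k; apply: CkM (hF c ac k) (hG c ac k); exact: chart_img_open.
Qed.

Lemma smooth_funV O (F : M -> R) : open O -> (forall q, O q -> F q != 0) ->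
  smooth_fun O F -> smooth_fun O (fun q => (F q)^-1).
Proof.
move=> Oo F0 hF c ac k; apply: CkV (hF c ac k); first exact: chart_img_open.
by move=> _ [q [cq Oq] <-] /=; rewrite ch_mapK //; exact: F0.
Qed.

Lemma smooth_fun_scalemx p' q' O (f : M -> R) (F : M -> 'M[R]_(p', q')) :
  open O -> smooth_fun O f -> smooth_fun O F ->
  smooth_fun O (fun q => f q *: F q).
Proof.
move=> Oo hF hG c ac k.
by apply: Ck_scalemx (hF c ac k) (hG c ac k); exact: chart_img_open.
Qed.

Lemma smooth_fun_mulmx p' q' r' O (F : M -> 'M[R]_(p', q'))
    (G : M -> 'M[R]_(q', r')) : open O ->
  smooth_fun O F -> smooth_fun O G -> smooth_fun O (fun q => F q *m G q).
Proof.
move=> Oo hF hG c ac k.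
by apply: Ck_mulmx (hF c ac k) (hG c ac k); exact: chart_img_open.
Qed.

Lemma smooth_fun_invmx p' O (F : M -> 'M[R]_p') : open O ->
  (forall q, O q -> F q \in unitmx) ->
  smooth_fun O F -> smooth_fun O (fun q => invmx (F q)).
Proof.
move=> Oo uF hF c ac k; apply: Ck_invmx (hF c ac k); first exact: chart_img_open.
by move=> _ [q [cq Oq] <-] /=; rewrite ch_mapK //; exact: uF.
Qed.

(** The chain rule for the transition from the preferred chart at [q]. Preferred
    charts may change abruptly with the point, so derivatives near a point are
    always moved to one fixed chart by this lemma. *)
Lemma mderiv_chart W O (F : M -> W) c q v : mf_atlas c -> ch_dom c q ->
  O q -> smooth_fun O F ->
  mderiv F q v = 'D_(mderiv (ch_map c) q v) (F \o ch_inv c) (ch_map c q).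
Proof.
move=> ac cq Oq hF; set c0 := mf_chart q.
have c0q : ch_dom c0 q := mf_chart_dom q.
have dc := smooth_fun_differentiable (mf_chart_atlas q) (smooth_fun_atlas ac) cq c0q.
have dF := smooth_fun_differentiable ac hF Oq cq.
rewrite /mderiv -/c0.
have <- : (ch_map c \o ch_inv c0) (ch_map c0 q) = ch_map c q by rewrite /= ch_mapK.
rewrite -derive_comp //; last by rewrite /= ch_mapK.
apply: near_eq_derive; have := chart_img_open c0 (ch_open_dom c).
rewrite openE => /(_ (ch_map c0 q)) h.
have /h : (ch_map c0 @` (ch_dom c0 `&` ch_dom c)) (ch_map c0 q) by exists q.
by apply: filterS => _ [r [c0r cr] <-] /=; rewrite !ch_mapK.
Qed.

Lemma mderiv_linear W O (F : M -> W) q (a : R) v w : O q -> smooth_fun O F ->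
  mderiv F q (a *: v + w) = a *: mderiv F q v + mderiv F q w.
Proof.
move=> Oq hF; apply: derive_linear.
exact: smooth_fun_differentiable (mf_chart_atlas q) hF Oq (mf_chart_dom q).
Qed.

Lemma mderiv_near_eq W O (F G : M -> W) q v : open O -> O q ->
  (forall r, O r -> F r = G r) -> mderiv F q v = mderiv G q v.
Proof.
move=> Oo Oq FG; apply: near_eq_derive.
have := chart_img_open (mf_chart q) Oo.
rewrite openE => /(_ (ch_map (mf_chart q) q)) h.
have /h : (ch_map (mf_chart q) @` (ch_dom (mf_chart q) `&` O)) (ch_map (mf_chart q) q).
  by exists q => //; split=> //; exact: mf_chart_dom.
by apply: filterS => _ [r [c0r Or] <-] /=; rewrite ch_mapK ?FG.
Qed.

Lemma mderiv_self (q : M) v : mderiv (ch_map (mf_chart q)) q v = v.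
Proof.
set c := mf_chart q; rewrite /mderiv -/c -[RHS](@derive_id _ _ (ch_map c q) v).
apply: near_eq_derive; have := @ch_open_img _ _ _ c.
rewrite openE => /(_ (ch_map c q)) h.
have /h : (ch_map c @` ch_dom c) (ch_map c q) by exists q => //; exact: mf_chart_dom.
by apply: filterS => x /ch_inv_img [].
Qed.

(** The coordinates of the preferred chart are themselves smooth functions, so
    [v] is recovered from its coordinates in [c]. *)
Lemma mderiv_ch_inj c (q : M) v : mf_atlas c -> ch_dom c q ->
  mderiv (ch_map c) q v = 0 -> v = 0.
Proof.
move=> ac cq v0; rewrite -(mderiv_self q v).
rewrite (mderiv_chart v ac cq (mf_chart_dom q)
  (smooth_fun_atlas (mf_chart_atlas q))).
by rewrite v0 derive0.
Qed.

Lemma smooth_field_chart O (X : M -> 'rV[R]_m) c : open O -> mf_atlas c ->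
  smooth_field O X -> smooth (ch_map c @` (ch_dom c `&` O))
    ((fun q => mderiv (ch_map c) q (X q)) \o ch_inv c).
Proof.
move=> Oo ac hX k; apply: Ck_subset (hX c ac c ac k).
by apply: image_subset => q [].
Qed.

(** In a chart this is a combination of partial derivatives of [F] with the
    coordinates of [X] as coefficients. *)
Lemma smooth_fun_mderiv p' q' O (F : M -> 'M[R]_(p', q')) (X : M -> 'rV[R]_m) :
  open O -> smooth_fun O F -> smooth_field O X ->
  smooth_fun O (fun q => mderiv F q (X q)).
Proof.
move=> Oo hF hX c ac k; have Uo := chart_img_open c Oo.
pose Xc x := mderiv (ch_map c) (ch_inv c x) (X (ch_inv c x)).
pose h x := \sum_j Xc x 0 j *: 'D_(delta_mx 0 j) (F \o ch_inv c) x.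
have [_ CF] := hF c ac k.+1.
apply: (@Ck_eq_open _ _ _ _ _ h) => //.
  move=> _ [q [cq Oq] <-] /=; rewrite /h /Xc ch_mapK //.
  rewrite (mderiv_chart _ ac cq Oq hF) [RHS]derive_row_sum //.
  exact: (smooth_fun_differentiable ac hF Oq cq).
apply: Ck_sum => // j; apply: Ck_scalemx => //; last exact: CF.
by have /(Ck_mxP _ _ Uo)/(_ 0 j) := smooth_field_chart Oo ac hX k.
Qed.

End Charts.

Arguments chart_img_open {R m M} c {O} _.

(** * Smooth maps between manifolds *)

Section ChartsMaps.
Context {R : realType} {m k : nat} {M : smoothManifold R m}
        {M' : smoothManifold R k}.

Lemma smooth_funB p' q' O (F G : M -> 'M[R]_(p', q')) : open O ->
  smooth_fun O F -> smooth_fun O G -> smooth_fun O (fun q => F q - G q).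
Proof.
move=> Oo hF hG; apply: smooth_funD => //.
under eq_fun do rewrite -scaleN1r.
by apply: smooth_fun_scalemx => //; exact: smooth_fun_cst.
Qed.

Lemma smooth_fun_comp p' q' (F : M -> M') O (G : M' -> 'M[R]_(p', q')) :
  smooth_map F -> open O -> smooth_fun O G -> smooth_fun (F @^-1` O) (G \o F).
Proof.
move=> [cF sF] Oo hG; apply/smooth_fun_ptwise => q Oq.
pose c' := mf_chart (F q); pose O1 := O `&` ch_dom c'.
have O1o : open O1 by apply: openI => //; exact: ch_open_dom.
have F1o : open (F @^-1` O1) by apply: open_comp => // ? _; exact: cF.
apply: (@smooth_fun_sub _ _ _ _ (F @^-1` O1)).
  by move=> _ ->; split=> //; exact: mf_chart_dom.
move=> c ac j; have Uo := chart_img_open c F1o.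
have ac' : mf_atlas c' := mf_chart_atlas _.
apply: (@Ck_eq_open _ _ _ _ _ ((G \o ch_inv c') \o ((ch_map c' \o F) \o ch_inv c))) => //.
  by move=> _ [r [cr [Or c'r]] <-] /=; rewrite !ch_mapK //.
apply: (Ck_comp_mx Uo (chart_img_open c' Oo) _ _ (hG c' ac' j)).
  by move=> _ [r [cr [Or c'r]] <-]; exists (F r); rewrite //= ch_mapK.
apply: Ck_subset (sF c' ac' c ac j).
by apply: image_subset => r [cr [Or c'r]].
Qed.

Lemma mderiv_comp p' q' (F : M -> M') O (G : M' -> 'M[R]_(p', q')) q v :
  smooth_map F -> O (F q) -> smooth_fun O G ->
  mderiv (G \o F) q v = mderiv G (F q) (tmap F q v).
Proof.
move=> [cF sF] Oq hG; set c := mf_chart q; set c' := mf_chart (F q).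
have cq : ch_dom c q := mf_chart_dom q.
have c'q : ch_dom c' (F q) := mf_chart_dom _.
have dF := smooth_fun_differentiable (mf_chart_atlas q) (sF c' (mf_chart_atlas _)) c'q cq.
have dG := smooth_fun_differentiable (mf_chart_atlas (F q)) hG Oq c'q.
rewrite /tmap /mderiv -/c -/c'.
have E : ((ch_map c' \o F) \o ch_inv c) (ch_map c q) = ch_map c' (F q).
  by rewrite /= ch_mapK.
rewrite -[in RHS]E -derive_comp; [|exact: dF|by rewrite E; exact: dG].
apply: near_eq_derive.
have Oo : open (F @^-1` ch_dom c').
  by apply: open_comp => [? _|]; [exact: cF|exact: ch_open_dom].
have := chart_img_open c Oo; rewrite openE => /(_ (ch_map c q)) h.
have /h : (ch_map c @` (ch_dom c `&` F @^-1` ch_dom c')) (ch_map c q) by exists q.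
by apply: filterS => _ [r [cr c'r] <-] /=; rewrite !ch_mapK.
Qed.

End ChartsMaps.

(** * The Euclidean inner product *)

Section Dot.
Context {R : realType} {m : nat}.
Implicit Types u v w : 'rV[R]_m.

Lemma dotE u v : dot u v = (u *m v^T) 0 0.
Proof. by rewrite mxE; apply: eq_bigr => i _; rewrite mxE. Qed.

Lemma dotC u v : dot u v = dot v u.
Proof. by apply: eq_bigr => i _; rewrite mulrC. Qed.

Lemma dotDl u v w : dot (u + v) w = dot u w + dot v w.
Proof. by rewrite !dotE mulmxDl mxE. Qed.

Lemma dotZl a u w : dot (a *: u) w = a * dot u w.
Proof. by rewrite !dotE -scalemxAl mxE. Qed.

Lemma dotNl u w : dot (- u) w = - dot u w.
Proof. by rewrite -scaleN1r dotZl mulN1r. Qed.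

Lemma dotBl u v w : dot (u - v) w = dot u w - dot v w.
Proof. by rewrite dotDl dotNl. Qed.

Lemma dot0l w : dot 0 w = 0.
Proof. by rewrite -(scale0r 0) dotZl mul0r. Qed.

Lemma dotDr u v w : dot w (u + v) = dot w u + dot w v.
Proof. by rewrite !(dotC w) dotDl. Qed.

Lemma dotZr a u w : dot w (a *: u) = a * dot w u.
Proof. by rewrite !(dotC w) dotZl. Qed.

Lemma dotNr u w : dot w (- u) = - dot w u.
Proof. by rewrite !(dotC w) dotNl. Qed.

Lemma dotBr u v w : dot w (u - v) = dot w u - dot w v.
Proof. by rewrite !(dotC w) dotBl. Qed.

Lemma dot0r w : dot w 0 = 0.
Proof. by rewrite dotC dot0l. Qed.

Lemma dot_suml (I : Type) (r : seq I) (P : pred I) (F : I -> 'rV[R]_m) w :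
  dot (\sum_(i <- r | P i) F i) w = \sum_(i <- r | P i) dot (F i) w.
Proof. by apply: (big_morph (dot ^~ w)) => [u v|]; [exact: dotDl|exact: dot0l]. Qed.

Lemma dot_eq0 u : dot u u = 0 -> u = 0.
Proof.
move=> /eqP; rewrite psumr_eq0 => [|i _]; last by rewrite -expr2 sqr_ge0.
move=> /allP h; apply/rowP => i; rewrite mxE.
by have := h i (mem_index_enum _); rewrite mulf_eq0 orbb => /eqP.
Qed.

Lemma dot_delta u j : dot u (delta_mx 0 j) = u 0 j.
Proof.
rewrite /dot (bigD1 j) //= big1 ?addr0 => [|i ij]; first by rewrite mxE !eqxx mulr1.
by rewrite mxE (negbTE ij) andbF mulr0.
Qed.

Lemma mulmx_dot u v : u *m v^T = (dot u v)%:M.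
Proof. by rewrite [LHS]mx11_scalar dotE. Qed.

Lemma derive_dot (V : normedModType R) (A B : V -> 'rV[R]_m) (x v : V) :
  differentiable A x -> differentiable B x ->
  'D_v (fun y => dot (A y) (B y)) x = dot ('D_v A x) (B x) + dot (A x) ('D_v B x).
Proof.
move=> dA dB; have dBT : differentiable (fun y => (B y)^T) x.
  apply/differentiable_mxP => i j; under eq_fun do rewrite mxE.
  by have /differentiable_mxP := dB; exact.
under eq_fun do rewrite dotE.
rewrite -(derive_entry (M := fun y => A y *m (B y)^T)).
  by rewrite derive_mulmx // derive_trmx // mxE !dotE.
exact: differentiable_mulmx.
Qed.

End Dot.

Lemma smooth_fun_dot (R : realType) k (M : smoothManifold R k) m O
    (F G : M -> 'rV[R]_m) : open O ->
  smooth_fun O F -> smooth_fun O G -> smooth_fun O (fun q => dot (F q) (G q)).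
Proof.
move=> Oo /(smooth_fun_mxP _ Oo) hF /(smooth_fun_mxP _ Oo) hG.
by apply: smooth_fun_sum => // i; exact: smooth_funM.
Qed.

(** * The Levi-Civita connection of the sphere *)

Lemma eq_subr_swap (V : zmodType) (a b c d : V) : a - b = c - d -> a - c = b - d.
Proof.
by move/(canRL (subrK _)) ->; rewrite -addrA addrC addrA subrK addrC.
Qed.

Section SphereConnection.
Context {R : realType} {m : nat}.
Implicit Types (b v w y : 'rV[R]_m).

Lemma metric_defect_skew (u v du dv Du Dv : 'rV[R]_m) :
  dot du v + dot u dv = dot Du v + dot u Dv ->
  dot (Du - du) v = - dot (Dv - dv) u.
Proof. rewrite !dotBl (dotC u) (dotC u); lra. Qed.

(** For a fixed [b] this is a tangent field on the whole sphere. These fields span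
    every tangent space, so every section of a pullback of the tangent bundle is a
    combination of them with functions as coefficients. *)
Definition tangent_proj b y : 'rV[R]_m := b - y *m b^T *m y.

Lemma tangent_projE b y : tangent_proj b y = b - dot y b *: y.
Proof. by rewrite /tangent_proj mulmx_dot mul_scalar_mx. Qed.

Lemma tangent_proj_id v y : dot y v = 0 -> tangent_proj v y = v.
Proof. by rewrite tangent_projE => ->; rewrite scale0r subr0. Qed.

Lemma sphere_field_tangent_proj b : sphere_field (tangent_proj b).
Proof.
split=> [|y yS]; last first.
  by rewrite tangent_projE dotBr dotZr yS mulr1 subrr.
exists setT; split=> // [|k]; first exact: openT.
apply: CkD; [exact: openT|exact: Ck_cst|].
under eq_fun do rewrite -scaleN1r.
apply: Ck_scalemx; [exact: openT|exact: Ck_cst|].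
apply: Ck_mulmx; [exact: openT| |exact: Ck_id].
by apply: Ck_mulmx; [exact: openT|exact: Ck_id|exact: Ck_cst].
Qed.

Lemma sphere_smooth_differentiable (V : normedModType R) (f : 'rV[R]_m -> V) y :
  sphere_smooth f -> sphere y -> differentiable f y.
Proof. by move=> [U [_ sU /(_ 1) [df _]]] /sU; exact: df. Qed.

Lemma derive_tangent_proj b v y :
  'D_v (tangent_proj b) y = - dot v b *: y - dot y b *: v.
Proof.
have d1 : differentiable (fun z : 'rV[R]_m => z *m b^T) y.
  by apply: differentiable_mulmx => //; exact: differentiable_cst.
have d2 : differentiable (fun z : 'rV[R]_m => z *m b^T *m z) y.
  exact: differentiable_mulmx.
rewrite deriveB; [|exact/diff_derivable/differentiable_cst|exact: diff_derivable].
rewrite derive_cst sub0r derive_mulmx // derive_mulmxr // derive_id.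
by rewrite !mulmx_dot !mul_scalar_mx opprD scaleNr.
Qed.

Variable D : 'rV[R]_m -> 'rV[R]_m -> ('rV[R]_m -> 'rV[R]_m) -> 'rV[R]_m.
Hypothesis LC : levi_civita_sphere D.

(** The Koszul argument: the defect of [D] against the flat derivative is
    symmetric in its first two slots and skew in its last two, so it vanishes. *)
Lemma levi_civita_defect a b c y : sphere y ->
  dot (D y (tangent_proj a y) (tangent_proj b)
       - 'D_(tangent_proj a y) (tangent_proj b) y) (tangent_proj c y) = 0.
Proof.
move=> yS; pose Y := tangent_proj; have fY a' := sphere_field_tangent_proj a'.
have dY a' : differentiable (Y a') y.
  by apply: sphere_smooth_differentiable yS; have [] := fY a'.
pose B a' b' c' := dot (D y (Y a' y) (Y b') - 'D_(Y a' y) (Y b') y) (Y c' y).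
have sym a' b' c' : B a' b' c' = B b' a' c'.
  have tf := lc_torsion_free LC yS (fY a') (fY b').
  exact: (congr1 (fun u => dot u (Y c' y)) (eq_subr_swap tf)).
have skew a' b' c' : B a' b' c' = - B a' c' b'.
  have tY : dot y (Y a' y) = 0 by have [_] := fY a'; exact.
  have E := etrans (esym (derive_dot (Y a' y) (dY b') (dY c')))
    (lc_metric LC yS tY (fY b') (fY c')).
  exact: metric_defect_skew E.
have E : B a b c = - B a b c.
  by rewrite [LHS]sym [LHS]skew [in LHS]sym [in LHS]skew opprK [LHS]sym [LHS]skew.
suff : B a b c = 0 by [].
by lra.
Qed.

(** [levi_civita_defect] fixes the tangential part of [D y v], and [D y v] is
    tangent because a connection maps tangent fields to tangent fields. *)
Lemma levi_civita_tangent_proj b v y : sphere y -> dot y v = 0 ->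
  D y v (tangent_proj b) = - dot y b *: v.
Proof.
move=> yS yv; have fY b' := sphere_field_tangent_proj b'.
have [Z [_ tZ] DZ] := sc_smooth (lc_connection LC) (fY v) (fY b).
have := DZ y (mem_set yS); rewrite tangent_proj_id // => {}DZ.
set w := D y v _ in DZ *.
have tw : dot y w = 0 by rewrite DZ tZ.
pose z := w + dot y b *: v.
have tz : dot y z = 0 by rewrite dotDr tw dotZr yv mulr0 addr0.
suff : z = 0 by move/eqP; rewrite addr_eq0 scaleNr => /eqP.
apply: dot_eq0; have := levi_civita_defect v b z yS.
rewrite tangent_proj_id // -/w tangent_proj_id // derive_tangent_proj.
rewrite opprB -scaleNr opprK addrA dotDl dotZl tz mulr0 addr0.
by [].
Qed.

End SphereConnection.

(** * The pullback connection *)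

Section PullbackConnection.
Context {R : realType} {m k : nat} {M : smoothManifold R k}.
Variables (D : 'rV[R]_m -> 'rV[R]_m -> ('rV[R]_m -> 'rV[R]_m) -> 'rV[R]_m)
  (g : M -> 'rV[R]_m)
  (P : M -> 'rV[R]_k -> (M -> 'rV[R]_m) -> 'rV[R]_m).
Hypotheses (LC : levi_civita_sphere D) (PC : pullback_connection D g P).
Hypotheses (gS : forall q, sphere (g q)) (smg : smooth_fun setT g).

Lemma dot_mderiv_sphere p v : dot (g p) (mderiv g p v) = 0.
Proof.
have dg := smooth_fun_differentiable (mf_chart_atlas p) smg I (mf_chart_dom p).
have := derive_dot v dg dg.
have -> : (fun x => dot ((g \o ch_inv (mf_chart p)) x) ((g \o ch_inv (mf_chart p)) x)) = fun=> 1.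
  by apply/funext => x; exact: gS.
rewrite derive_cst /= ch_mapK; last exact: mf_chart_dom.
by rewrite (dotC (derive _ _ _)) -/(mderiv g p v); lra.
Qed.

(** Leibniz' rule for the indicator function of [O], which is smooth on [O],
    makes the pullback connection local. *)
Lemma pullback_local (O : set M) p v s s' : open O -> O p ->
  pullback_section g O s -> pullback_section g O s' ->
  (forall q, O q -> s q = s' q) -> P p v s = P p v s'.
Proof.
move=> Oo Op hs hs' ss'.
(* Being smooth on [O] says nothing about the values outside of [O]. *)
pose f q : R := (q \in O)%:R.
have f1 q : O q -> f q = 1 by rewrite /f => /mem_set ->.
have sf : smooth_fun O f.
  apply: (smooth_fun_eq Oo) (smooth_fun_cst O (1 : R)) => q Oq.
  by rewrite f1.
have df : mderiv f p v = 0.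
  rewrite (mderiv_near_eq (G := fun=> 1 : R) v Oo Op f1).
  exact: derive_cst.
have cut t : pullback_section g O t -> P p v t = P p v (fun q => f q *: t q).
  by move=> ht; rewrite (pc_leibniz PC v Oo Op sf ht) df f1 // scale0r add0r scale1r.
rewrite (cut s) // (cut s') //; congr (P p v _); apply/funext => q.
rewrite /f; case: (boolP (q \in O)) => [/set_mem/ss' -> //|_].
by rewrite !scale0r.
Qed.

Lemma pullback_sum (O : set M) p v (I : Type) (r : seq I) (s : I -> M -> 'rV[R]_m) :
  open O -> O p -> (forall i, pullback_section g O (s i)) ->
  P p v (fun q => \sum_(i <- r) s i q) = \sum_(i <- r) P p v (s i).
Proof.
move=> Oo Op hs.
have hsum r' : pullback_section g O (fun q => \sum_(i <- r') s i q).
  split=> [|q Oq]; first by apply: smooth_fun_sum => // i; have [] := hs i.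
  by rewrite dotC dot_suml big1 // => i _; rewrite dotC; have [_] := hs i; exact.
elim: r => [|i r IH].
  have := pc_add PC v Oo Op (hsum [::]) (hsum [::]).
  rewrite [in X in _ -> _ = X]big_nil.
  have -> : (fun q => \sum_(i <- [::]) s i q + \sum_(i <- [::]) s i q) =
      (fun q => \sum_(i <- [::]) s i q).
    by apply/funext => q; rewrite big_nil addr0.
  by move/eqP; rewrite -subr_eq subrr eq_sym => /eqP.
rewrite big_cons -IH -(pc_add PC v Oo Op (hs i) (hsum r)).
by congr (P p v _); apply/funext => q; rewrite big_cons.
Qed.

Lemma tangent_proj_frame (u y : 'rV[R]_m) : dot y u = 0 ->
  \sum_j u 0 j *: tangent_proj (delta_mx 0 j) y = u.
Proof.
move=> yu; under eq_bigr do rewrite tangent_projE scalerBr scalerA dot_delta.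
rewrite sumrB -row_sum_delta -scaler_suml.
have -> : \sum_j u 0 j * y 0 j = dot u y by [].
by rewrite dotC yu scale0r subr0.
Qed.

(** The pullback connection is the projected flat derivative: a section is a
    combination, with functions on [M] as coefficients, of pullbacks of the
    projected constant fields, whose derivatives are known. *)
Lemma pullback_sphereE (O : set M) p v s : open O -> O p ->
  pullback_section g O s -> P p v s = tangent_proj (mderiv s p v) (g p).
Proof.
move=> Oo Op hs; have [ss ts] := hs.
pose Y j : 'rV[R]_m -> 'rV[R]_m := tangent_proj (delta_mx 0 j).
have sg : smooth_fun O g by exact: smooth_fun_sub smg.
have fY j : pullback_section g O (Y j \o g).
  split=> [|q _]; last first.
    exact: (sphere_field_tangent_proj (delta_mx 0 j)).2 _ (gS q).
  apply: smooth_funB => //; first exact: smooth_fun_cst.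
  apply: smooth_fun_mulmx => //; apply: smooth_fun_mulmx => //.
  exact: smooth_fun_cst.
have sj j : smooth_fun O (fun q => s q 0 j) by have /(smooth_fun_mxP _ Oo) := ss; exact.
have fsY j : pullback_section g O (fun q => s q 0 j *: (Y j \o g) q).
  split=> [|q Oq]; first by apply: smooth_fun_scalemx => //; have [] := fY j.
  by rewrite dotZr (fY j).2 // mulr0.
have sE : P p v s = P p v (fun q => \sum_j s q 0 j *: (Y j \o g) q).
  apply: (pullback_local v Oo Op hs).
    split=> [|q Oq].
      by apply: smooth_fun_sum => // j; have [] := fsY j.
    by rewrite tangent_proj_frame ?ts.
  by move=> q Oq; rewrite tangent_proj_frame ?ts.
rewrite sE (pullback_sum v _ Oo Op fsY).
have dge0 := dot_mderiv_sphere p v.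
under eq_bigr => j _.
  rewrite (pc_leibniz PC v Oo Op (sj j) (fY j)).
  rewrite (pc_pullback PC p v (sphere_field_tangent_proj _)).
  rewrite (levi_civita_tangent_proj LC) // dot_delta scalerA.
  over.
rewrite big_split /= -scaler_suml.
have -> : \sum_j s p 0 j * - g p 0 j = 0.
  under eq_bigr do rewrite mulrN.
  by rewrite sumrN -[X in - X]/(dot (s p) (g p)) dotC ts // oppr0.
rewrite scale0r addr0.
have ds := smooth_fun_differentiable (mf_chart_atlas p) ss Op (mf_chart_dom p).
under eq_bigr => j _.
  have -> : mderiv (fun q => s q 0 j) p v = (mderiv s p v) 0 j.
    by rewrite [RHS](derive_entry _ _ _ ds).
  rewrite /= /Y tangent_projE scalerBr scalerA dot_delta.
  over.
by rewrite sumrB -row_sum_delta -scaler_suml tangent_projE dotC.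
Qed.

End PullbackConnection.

(** * The Lie bracket *)

Section LieBracket.
Context {R : realType} {m : nat} {M : smoothManifold R m}.

Lemma derive_swap_mx (V : normedModType R) p' q' (f : V -> 'M[R]_(p', q'))
    (U : set V) (x u v : V) : open U -> U x -> Ck 2 U f ->
  'D_u (fun y => 'D_v f y) x = 'D_v (fun y => 'D_u f y) x.
Proof.
move=> Uo Ux Cf; have [df dDf] := Cf; apply/matrixP => i j.
have dDfx w : differentiable (fun y => 'D_w f y) x by have [d _] := dDf w; exact: d.
have Cij : Ck 2 U (fun y => f y i j) by have /(Ck_mxP _ _ Uo) := Cf; exact.
have near_entry w : \forall y \near x,
    ('D_w f y) i j = 'D_w (fun z => f z i j) y.
  apply: filterS (open_nbhs_nbhs (conj Uo Ux)) => y Uy.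
  by rewrite derive_entry //; exact: df.
apply: etrans (derive_entry u i j (dDfx v)) _.
apply: etrans _ (esym (derive_entry v i j (dDfx u))).
apply: etrans (near_eq_derive u (near_entry v)) _.
apply: etrans _ (esym (near_eq_derive v (near_entry u))).
exact: derive_swap Uo Ux Cij.
Qed.

Lemma jacobian_entry n' p' (f : 'rV[R]_n' -> 'rV[R]_p') x i j :
  differentiable f x -> jacobian f x i j = ('D_(delta_mx 0 i) f x) 0 j.
Proof. by move=> df; rewrite deriveEjacobian // -rowE [in RHS]mxE. Qed.

(** The product rule for [Y y *m jacobian f y]: one term differentiates the
    direction, the other the function along a frozen direction. *)
Lemma derive_along (n' p' : nat) (f : 'rV[R]_n' -> 'rV[R]_p') (U : set 'rV[R]_n')
    (Y : 'rV[R]_n' -> 'rV[R]_n') x u : open U -> U x -> Ck 2 U f ->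
  differentiable Y x ->
  'D_u (fun y => 'D_(Y y) f y) x =
  'D_('D_u Y x) f x + 'D_u (fun y => 'D_(Y x) f y) x.
Proof.
move=> Uo Ux [df Cf] dY; pose J y := jacobian f y.
have JE v : \forall y \near x, 'D_v f y = v *m J y.
  apply: filterS (open_nbhs_nbhs (conj Uo Ux)) => y Uy.
  by rewrite deriveEjacobian //; exact: df.
have dJ : differentiable J x.
  apply/differentiable_mxP => i j.
  have [dDf _] := Cf (delta_mx 0 i).
  have /differentiable_mxP/(_ 0 j) := dDf x Ux.
  apply: near_eq_differentiable.
  apply: filterS (open_nbhs_nbhs (conj Uo Ux)) => y Uy.
  by rewrite /J [RHS]jacobian_entry //; exact: df.
have YE : \forall y \near x, 'D_(Y y) f y = Y y *m J y.
  apply: filterS (open_nbhs_nbhs (conj Uo Ux)) => y Uy.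
  by rewrite deriveEjacobian //; exact: df.
rewrite (near_eq_derive _ YE) (near_eq_derive _ (JE (Y x))).
have dYx : differentiable (fun=> Y x) x by exact: differentiable_cst.
rewrite (derive_mulmx _ dY dJ) (derive_mulmx _ dYx dJ) derive_cst mul0mx add0r.
by rewrite (nbhs_singleton (JE _)).
Qed.

(** On functions the bracket acts as the commutator: in a chart, the terms
    with second derivatives of the function cancel. *)
Lemma mderiv_lie p' (O : set M) (G : M -> 'rV[R]_p') X Y q : open O -> O q ->
  smooth_fun O G -> smooth_field O X -> smooth_field O Y ->
  mderiv (fun r => mderiv G r (Y r)) q (X q)
  - mderiv (fun r => mderiv G r (X r)) q (Y q) = mderiv G q (lie X Y q).
Proof.
move=> Oo Oq hG hX hY; set c := mf_chart q.
have ac : mf_atlas c := mf_chart_atlas q.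
have cq : ch_dom c q := mf_chart_dom q.
pose co Z x := mderiv (ch_map c) (ch_inv c x) (Z (ch_inv c x)).
have Uo := chart_img_open c Oo; set U := ch_map c @` _ in Uo.
have Uq : U (ch_map c q) by exists q.
have CG := hG c ac 2.
have dco Z : smooth_field O Z -> differentiable (co Z) (ch_map c q).
  by move=> hZ; have [d _] := smooth_field_chart Oo ac hZ 1; exact: d.
have step Z u : smooth_field O Z -> mderiv (fun r => mderiv G r (Z r)) q u =
    mderiv G q (mderiv (fun r => mderiv (ch_map c) r (Z r)) q u)
    + 'D_u (fun y => 'D_(Z q) (G \o ch_inv c) y) (ch_map c q).
  move=> hZ; have -> : Z q = co Z (ch_map c q) by rewrite /co ch_mapK // mderiv_self.
  rewrite -(derive_along u Uo Uq CG (dco Z hZ)).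
  apply: near_eq_derive; apply: filterS (open_nbhs_nbhs (conj Uo Uq)).
  move=> _ [r [cr Or] <-] /=; rewrite /co ch_mapK //.
  exact: mderiv_chart ac cr Or hG.
apply: etrans (congr2 (fun a b => a - b) (step Y (X q) hY) (step X (Y q) hX)) _.
have cancel (V : zmodType) (a b s t : V) : s = t -> a + s - (b + t) = a - b.
  by move=> ->; rewrite opprD addrACA subrr addr0.
apply: etrans (cancel _ _ _ _ _ (derive_swap_mx (X q) (Y q) Uo Uq CG)) _.
have lin a b : mderiv G q (a - b) = mderiv G q a - mderiv G q b.
  by rewrite addrC -scaleN1r (mderiv_linear _ _ _ Oq hG) scaleN1r addrC.
exact: esym (lin _ _).
Qed.

End LieBracket.

(** * Calculus of directional derivatives on a manifold *)

Section MDeriv.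
Context {R : realType} {m : nat} {M : smoothManifold R m}.
Variables (O : set M) (q : M).
Hypotheses (Oq : O q).

Lemma mderivB (W : normedModType R) (F : M -> W) u v : smooth_fun O F ->
  mderiv F q (u - v) = mderiv F q u - mderiv F q v.
Proof.
by move=> hF; rewrite addrC -scaleN1r (mderiv_linear _ _ _ Oq hF) scaleN1r addrC.
Qed.

Lemma mderiv0 (W : normedModType R) (F : M -> W) : mderiv F q 0 = 0.
Proof. exact: derive0. Qed.

Lemma mderiv_cst (W : normedModType R) (a : W) v : mderiv (fun=> a) q v = 0.
Proof. exact: derive_cst. Qed.

Lemma mderiv_mulmxl (W : normedModType R) (F : M -> W) k (a : 'rV[R]_k)
    (B : 'M[R]_(k, m)) : smooth_fun O F ->
  mderiv F q (a *m B) = \sum_i a 0 i *: mderiv F q (row i B).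
Proof.
move=> hF; rewrite mulmx_sum_row.
elim: (index_enum _) => [|i s IH]; first by rewrite !big_nil mderiv0.
by rewrite !big_cons -IH (mderiv_linear _ _ _ Oq hF).
Qed.

Lemma smooth_fun_differentiable_self (W : normedModType R) (F : M -> W) :
  smooth_fun O F ->
  differentiable (F \o ch_inv (mf_chart q)) (ch_map (mf_chart q) q).
Proof.
move=> hF; apply: smooth_fun_differentiable (mf_chart_atlas q) hF Oq _.
exact: mf_chart_dom.
Qed.

Lemma mderivD (W : normedModType R) (F G : M -> W) v :
  smooth_fun O F -> smooth_fun O G ->
  mderiv (fun r => F r + G r) q v = mderiv F q v + mderiv G q v.
Proof.
move=> /smooth_fun_differentiable_self dF /smooth_fun_differentiable_self dG.
exact: (deriveD (diff_derivable dF) (diff_derivable dG)).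
Qed.

Lemma mderiv_mulmx p' q' r' (F : M -> 'M[R]_(p', q')) (G : M -> 'M[R]_(q', r')) v :
  smooth_fun O F -> smooth_fun O G ->
  mderiv (fun r => F r *m G r) q v = mderiv F q v *m G q + F q *m mderiv G q v.
Proof.
move=> /smooth_fun_differentiable_self dF /smooth_fun_differentiable_self dG.
apply: etrans (derive_mulmx v dF dG) _.
by rewrite /= ch_mapK //; exact: mf_chart_dom.
Qed.

Lemma mderiv_dot k (F G : M -> 'rV[R]_k) v :
  smooth_fun O F -> smooth_fun O G ->
  mderiv (fun r => dot (F r) (G r)) q v =
  dot (mderiv F q v) (G q) + dot (F q) (mderiv G q v).
Proof.
move=> /smooth_fun_differentiable_self dF /smooth_fun_differentiable_self dG.
apply: etrans (derive_dot v dF dG) _.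
by rewrite /= ch_mapK //; exact: mf_chart_dom.
Qed.

End MDeriv.

Lemma unitmx_kernel0 (F : fieldType) n (A : 'M[F]_n) :
  (forall a : 'rV[F]_n, a *m A = 0 -> a = 0) -> A \in unitmx.
Proof.
move=> h; rewrite -row_free_unit -kermx_eq0; apply/eqP/row_matrixP => i.
by rewrite row0; apply: h; rewrite -row_mul mulmx_ker row0.
Qed.

(** * The torsion in frame coefficients *)

Section Torsion.
Context {R : realType} {m : nat} (Mt : weitzenbock R m).
Implicit Types (q : Mt) (a b : 'rV[R]_m).

Definition frame_field (i : 'I_m) (q : Mt) : 'rV[R]_m := row i (wz_frame q).

Lemma coefK q v : coef q v *m wz_frame q = v.
Proof. by rewrite /coef mulmxKV // wz_frame_basis. Qed.

Lemma coef_frame q a : coef q (a *m wz_frame q) = a.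
Proof. by rewrite /coef mulmxK // wz_frame_basis. Qed.

(** Frame coefficients are differentiated through this matrix, which is smooth in
    [q] for a fixed chart, whereas [wz_frame] is read in a chart depending on the
    point. *)
Definition chart_frame (c : chart R m Mt) (q : Mt) : 'M[R]_m :=
  \matrix_i mderiv (ch_map c) q (frame_field i q).

Lemma mderiv_coef (c : chart R m Mt) q a : mf_atlas c -> ch_dom c q ->
  mderiv (ch_map c) q (a *m wz_frame q) = a *m chart_frame c q.
Proof.
move=> ac cq; rewrite (mderiv_mulmxl cq) ?mulmx_sum_row.
  by apply: eq_bigr => i _; rewrite rowK.
exact: smooth_fun_atlas.
Qed.

Lemma chart_frame_unit (c : chart R m Mt) q : mf_atlas c -> ch_dom c q ->
  chart_frame c q \in unitmx.
Proof.
move=> ac cq; apply: unitmx_kernel0 => a.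
rewrite -mderiv_coef // => /(mderiv_ch_inj ac cq) a0.
by rewrite -(coef_frame q a) a0 /coef mul0mx.
Qed.

Lemma coef_chart (c : chart R m Mt) q v : mf_atlas c -> ch_dom c q ->
  coef q v = mderiv (ch_map c) q v *m invmx (chart_frame c q).
Proof.
move=> ac cq; rewrite -[in RHS](coefK q v) mderiv_coef // mulmxK //.
exact: chart_frame_unit.
Qed.

Lemma chart_frame_self q : chart_frame (mf_chart q) q = wz_frame q.
Proof. by apply/row_matrixP => i; rewrite rowK mderiv_self. Qed.

Lemma smooth_chart_frame (c : chart R m Mt) : mf_atlas c ->
  smooth_fun (ch_dom c) (chart_frame c).
Proof.
move=> ac; apply/smooth_fun_mxP => [|i j]; first exact: ch_open_dom.
have := wz_frame_smooth (w := Mt) i ac; rewrite setTI.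
have co : open (ch_dom c) := ch_open_dom c.
move=> /(smooth_fun_mxP _ co)/(_ 0 j); apply: smooth_fun_eq => // q _.
by rewrite mxE.
Qed.

Lemma wz_nabla_parallel X a q : wz_nabla X (fun r => a *m wz_frame r) q = 0.
Proof.
rewrite /wz_nabla /wz_conn.
have -> : (fun r : Mt => coef (id r) (a *m wz_frame r)) = fun=> a.
  by apply/funext => r; exact: coef_frame.
by rewrite mderiv_cst mul0mx.
Qed.

Lemma smooth_parallel a : smooth_field setT (fun r : Mt => a *m wz_frame r).
Proof.
move=> c ac; rewrite setTI.
have co : open (ch_dom c) := ch_open_dom c.
apply: (@smooth_fun_eq _ _ _ _ _ (fun r => a *m chart_frame c r)) => // [r cr|].
  by rewrite mderiv_coef.
apply: smooth_fun_mulmx => //; first exact: smooth_fun_cst.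
exact: smooth_chart_frame.
Qed.

Lemma torsion_parallel a b q :
  torsion (fun r => a *m wz_frame r) (fun r => b *m wz_frame r) q =
  - lie (fun r => a *m wz_frame r) (fun r => b *m wz_frame r) q.
Proof. by rewrite /torsion !wz_nabla_parallel subrr sub0r. Qed.

(** The vectors [a] and [b] are extended with constant coefficients, that is, as
    parallel fields. Sums of such fields are again of this form, so skew-symmetry
    can be polarized. *)
Definition frame_torsion q a b : 'rV[R]_m :=
  coef q (torsion (fun r => a *m wz_frame r) (fun r => b *m wz_frame r) q).

Lemma frame_torsionE q a b :
  frame_torsion q a b = 
  (a *m mderiv (chart_frame (mf_chart q)) q (b *m wz_frame q)
   - b *m mderiv (chart_frame (mf_chart q)) q (a *m wz_frame q))
  *m invmx (wz_frame q).
Proof.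
have ac := mf_chart_atlas q; have cq : ch_dom (mf_chart q) q := mf_chart_dom q.
have sc := smooth_chart_frame ac.
have D b' v : mderiv (fun r => mderiv (ch_map (mf_chart q)) r (b' *m wz_frame r)) q v
    = b' *m mderiv (chart_frame (mf_chart q)) q v.
  have E r : ch_dom (mf_chart q) r ->
      mderiv (ch_map (mf_chart q)) r (b' *m wz_frame r) =
      b' *m chart_frame (mf_chart q) r.
    by move=> cr; rewrite mderiv_coef.
  rewrite (mderiv_near_eq v (ch_open_dom _) cq E).
  by rewrite (mderiv_mulmx cq v (smooth_fun_cst _ _) sc) mderiv_cst mul0mx add0r.
by rewrite /frame_torsion torsion_parallel /lie !D opprB /coef.
Qed.

End Torsion.

Lemma dot_alternating (R : realType) m (f : 'rV[R]_m -> 'rV[R]_m) :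
  {morph f : u v / u + v} -> (forall u, dot u (f u) = 0) ->
  forall u v, dot u (f v) = - dot v (f u).
Proof.
move=> fD f0 u v; have := f0 (u + v).
by rewrite fD dotDl !dotDr !f0 add0r addr0 => /eqP; rewrite addr_eq0 => /eqP.
Qed.

Section TorsionAlgebra.
Context {R : realType} {m : nat} (Mt : weitzenbock R m).
Implicit Types (q : Mt) (a b c : 'rV[R]_m).

Lemma frame_torsionC q a b : frame_torsion q a b = - frame_torsion q b a.
Proof. by rewrite (frame_torsionE q a b) (frame_torsionE q b a) -[RHS]mulNmx opprB. Qed.

Lemma frame_torsion_linearr q a b b' (s : R) :
  frame_torsion q a (s *: b + b') = s *: frame_torsion q a b + frame_torsion q a b'.
Proof.
have ac := mf_chart_atlas q.
have cq : ch_dom (mf_chart q) q := mf_chart_dom q.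
have sc := smooth_chart_frame ac.
rewrite (frame_torsionE q a b) (frame_torsionE q a b') (frame_torsionE q a (_ + _)).
have -> : (s *: b + b') *m wz_frame q = s *: (b *m wz_frame q) + b' *m wz_frame q.
  by rewrite mulmxDl scalemxAl.
rewrite (mderiv_linear _ _ _ cq sc) [in RHS]scalemxAl -[RHS]mulmxDl.
apply: (congr1 (mulmx^~ (invmx (wz_frame q)))).
move: (mderiv _ q _) (mderiv _ q _) (mderiv _ q _) => X X' Y.
by rewrite mulmxDr mulmxDl -scalemxAr -scalemxAl scalerBr opprD addrACA.
Qed.

Lemma frame_torsionDr q a b b' :
  frame_torsion q a (b + b') = frame_torsion q a b + frame_torsion q a b'.
Proof. by rewrite -{1}(scale1r b) frame_torsion_linearr scale1r. Qed.

Lemma frame_torsion0r q a : frame_torsion q a 0 = 0.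
Proof.
by have /(congr1 (fun z => z - frame_torsion q a 0)) := frame_torsionDr q a 0 0;
   rewrite addr0 addrK subrr.
Qed.

Lemma frame_torsion0l q a : frame_torsion q 0 a = 0.
Proof. by rewrite frame_torsionC frame_torsion0r oppr0. Qed.

Definition torsion_mx q a : 'M[R]_m := \matrix_j frame_torsion q a (delta_mx 0 j).

Lemma torsion_mxE q a b : frame_torsion q a b = b *m torsion_mx q a.
Proof.
rewrite mulmx_sum_row [in LHS](row_sum_delta b).
elim: (index_enum _) => [|i s IH]; first by rewrite !big_nil frame_torsion0r.
by rewrite !big_cons frame_torsion_linearr IH rowK.
Qed.

(** The bracket in [torsion] is read in the preferred chart of the point.
    [mderiv_lie], applied to the coordinate map of a fixed chart, moves it there. *)
Lemma smooth_frame_torsion a b :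
  smooth_fun setT (fun q : Mt => frame_torsion q a b).
Proof.
pose A (r : Mt) := a *m wz_frame r; pose B (r : Mt) := b *m wz_frame r.
apply/smooth_fun_ptwise => p _; set c := mf_chart p.
have ac : mf_atlas c := mf_chart_atlas p; have co : open (ch_dom c) := ch_open_dom c.
have sA : smooth_field (ch_dom c) A.
  by move=> c' ac'; apply: smooth_fun_sub (smooth_parallel a ac') => r [].
have sB : smooth_field (ch_dom c) B.
  by move=> c' ac'; apply: smooth_fun_sub (smooth_parallel b ac') => r [].
have sc := smooth_fun_atlas ac.
apply: (@smooth_fun_sub _ _ _ _ (ch_dom c)); first by move=> _ ->; exact: mf_chart_dom.
pose L r := mderiv (fun s => mderiv (ch_map c) s (B s)) r (A r)
            - mderiv (fun s => mderiv (ch_map c) s (A s)) r (B r).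
apply: (@smooth_fun_eq _ _ _ _ _ (fun r => (- 1%:M *m L r) *m invmx (chart_frame c r))) => //.
  move=> r cr; rewrite /frame_torsion torsion_parallel (coef_chart _ ac cr).
  rewrite /L (mderiv_lie co cr sc sA sB) mulNmx mul1mx; congr (_ *m _).
  by rewrite -[X in _ = mderiv _ _ X]sub0r [RHS](mderivB cr _ _ sc)
    mderiv0 sub0r.
apply: smooth_fun_mulmx => //; last first.
  apply: smooth_fun_invmx => // [r cr|]; first exact: chart_frame_unit.
  exact: smooth_chart_frame.
apply: smooth_fun_mulmx => //; first exact: smooth_fun_cst.
apply: smooth_funB => //; apply: smooth_fun_mderiv => //; exact: smooth_fun_mderiv.
Qed.

(** Fields with constant coefficients are parallel, so for these the covariant
    derivative of the torsion is the derivative of its coefficients. *)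
Lemma parallel_frame_torsion q a b v : parallel_torsion Mt ->
  mderiv (fun r : Mt => frame_torsion r a b) q v = 0.
Proof.
move=> par; pose A (r : Mt) := a *m wz_frame r; pose B (r : Mt) := b *m wz_frame r.
pose Z (r : Mt) := coef q v *m wz_frame r; pose Z0 (r : Mt) := (0 : 'rV[R]_m) *m wz_frame r.
have parA : wz_nabla Z A = Z0.
  by apply/funext => r; rewrite /Z0 mul0mx; exact: wz_nabla_parallel.
have parB : wz_nabla Z B = Z0.
  by apply/funext => r; rewrite /Z0 mul0mx; exact: wz_nabla_parallel.
have tors0 X Y : coef q (torsion X Y q) = 0 -> torsion X Y q = 0.
  by move=> E; rewrite -[LHS](coefK q) E mul0mx.
have := par A B Z (smooth_parallel a) (smooth_parallel b) (smooth_parallel _) q.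
rewrite parA parB (tors0 _ _ (frame_torsion0l q b)) (tors0 _ _ (frame_torsion0r q a)).
rewrite !subr0 => /(congr1 (coef q)); rewrite [LHS]coef_frame.
by rewrite /Z coefK /coef mul0mx.
Qed.

(** Polarization of the vanishing on the diagonal. *)
Lemma skew_frame_torsion q a b c : skew_torsion Mt ->
  dot a (frame_torsion q b c) = - dot c (frame_torsion q b a).
Proof.
move=> sk; have h x : dot x (frame_torsion q b x) = 0.
  have /(_ (or_intror (or_intror erefl)) q) :=
    sk _ _ _ (smooth_parallel x) (smooth_parallel b) (smooth_parallel x).
  by rewrite /wz_metric coef_frame.
exact: dot_alternating (frame_torsionDr q b) h a c.
Qed.

Lemma torsion_mx_skew q a : skew_torsion Mt -> (torsion_mx q a)^T = - torsion_mx q a.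
Proof.
move=> sk; apply/matrixP => i j; rewrite [LHS]mxE [RHS]mxE.
have tE i' j' : torsion_mx q a i' j' =
    dot (delta_mx 0 j') (frame_torsion q a (delta_mx 0 i')).
  by rewrite dotC dot_delta [LHS]mxE.
rewrite (tE j i) (tE i j); exact: skew_frame_torsion.
Qed.

End TorsionAlgebra.

(** * The structure equation *)

Lemma mulmx_solve (R : fieldType) m (A D1 D2 : 'M[R]_m) (x y z u v : 'rV[R]_m) :
  A \in unitmx -> x *m A + v *m D1 - (y *m A + u *m D2) = z *m A ->
  x - y - z = (u *m D2 - v *m D1) *m invmx A.
Proof.
move=> uA E; apply: (can_inj (mulmxK uA)); rewrite mulmxKV // !mulmxBl -E.
move: (x *m A) (y *m A) (u *m D2) (v *m D1) => X Y U V.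
have -> : X + V - (Y + U) = (X - Y) + (V - U) by rewrite opprD addrACA.
by rewrite opprD addrA subrr add0r opprB.
Qed.

Section Cartan.
Context {R : realType} {m k : nat} {M : smoothManifold R k} {Mt : weitzenbock R m}.
Variables (F : M -> Mt) (sF : smooth_map F).

Lemma smooth_pullback_coef (O : set M) X : open O -> smooth_field O X ->
  smooth_fun O (fun r => coef (F r) (tmap F r (X r))).
Proof.
move=> Oo hX; apply/smooth_fun_ptwise => q Oq; set c := mf_chart (F q).
have ac : mf_atlas c := mf_chart_atlas _; have sc := smooth_fun_atlas ac.
have co : open (F @^-1` ch_dom c).
  by apply: open_comp => [? _|]; [exact: sF.1|exact: ch_open_dom].
pose O1 := O `&` F @^-1` ch_dom c; have O1o : open O1 by exact: openI.
apply: (@smooth_fun_sub _ _ _ _ O1).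
  by move=> _ ->; split=> //; exact: mf_chart_dom.
have hX1 : smooth_field O1 X.
  by move=> c' ac'; apply: smooth_fun_sub (hX c' ac') => r [[? ?] ?].
have sf : smooth_fun O1 (ch_map c \o F).
  by apply: smooth_fun_sub (sF.2 c ac) => r [].
apply: (@smooth_fun_eq _ _ _ _ _ (fun r =>
    mderiv (ch_map c \o F) r (X r) *m invmx (chart_frame c (F r)))) => //.
  move=> r [_ cr]; rewrite (coef_chart _ ac cr).
  by rewrite -(mderiv_comp (O := ch_dom c) (X r) sF cr sc).
apply: smooth_fun_mulmx => //; first exact: smooth_fun_mderiv.
apply: smooth_fun_invmx => // [r [_ cr]|]; first exact: chart_frame_unit.
apply: smooth_fun_sub (smooth_fun_comp sF (ch_open_dom c) (smooth_chart_frame ac)).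
by move=> r [].
Qed.

(** Cartan's structure equation for the coframe pulled back by [F]. In a chart the
    coefficients of the image of [Y] are the derivative of [F] along [Y] divided by
    the frame. The second derivatives of [F] cancel, and the derivatives of the frame
    make up the brackets of the frame fields, which are minus their torsion. *)
Lemma structure_equation (O : set M) X Y q : open O -> O q ->
  smooth_field O X -> smooth_field O Y ->
  mderiv (fun r => coef (F r) (tmap F r (Y r))) q (X q)
  - mderiv (fun r => coef (F r) (tmap F r (X r))) q (Y q)
  - coef (F q) (tmap F q (lie X Y q)) =
  frame_torsion (F q) (coef (F q) (tmap F q (X q))) (coef (F q) (tmap F q (Y q))).
Proof.
move=> Oo Oq hX hY; set c := mf_chart (F q).
have ac : mf_atlas c := mf_chart_atlas _.
have cq : ch_dom c (F q) := mf_chart_dom _.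
pose f := ch_map c \o F; pose Fr r := chart_frame c (F r).
pose w Z r := coef (F r) (tmap F r (Z r)).
pose O1 := O `&` F @^-1` ch_dom c.
have co : open (F @^-1` ch_dom c).
  by apply: open_comp => [? _|]; [exact: sF.1|exact: ch_open_dom].
have O1o : open O1 by exact: openI.
have O1q : O1 q by [].
have sub Z : smooth_field O Z -> smooth_field O1 Z.
  by move=> hZ c' ac'; apply: smooth_fun_sub (hZ c' ac') => r [[? ?] ?].
have sf : smooth_fun O1 f.
  by apply: smooth_fun_sub (sF.2 c ac) => r [].
have sFr : smooth_fun O1 Fr.
  apply: smooth_fun_sub (smooth_fun_comp sF (ch_open_dom c) (smooth_chart_frame ac)).
  by move=> r [].
have wE Z r : O1 r -> w Z r = mderiv f r (Z r) *m invmx (Fr r).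
  move=> [_ cr]; rewrite /w (coef_chart _ ac cr).
  by rewrite -(mderiv_comp (O := ch_dom c) (Z r) sF cr (smooth_fun_atlas ac)).
have sw Z : smooth_field O1 Z -> smooth_fun O1 (w Z).
  exact: smooth_pullback_coef.
have dw Z u : smooth_field O1 Z ->
    mderiv (fun r => mderiv f r (Z r)) q u = 
    mderiv (w Z) q u *m Fr q + w Z q *m mderiv Fr q u.
  move=> hZ; rewrite -(mderiv_mulmx O1q u (sw Z hZ) sFr).
  apply: (mderiv_near_eq u O1o O1q) => r O1r.
  by rewrite wE // mulmxKV //; apply: chart_frame_unit => //; case: O1r.
have Frq : Fr q = wz_frame (F q) by rewrite /Fr chart_frame_self.
have dFr u : mderiv Fr q u =
    mderiv (chart_frame c) (F q) (coef (F q) (tmap F q u) *m wz_frame (F q)).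
  by rewrite coefK -(mderiv_comp u sF cq (smooth_chart_frame ac)).
have hX1 := sub X hX; have hY1 := sub Y hY.
have lE : mderiv f q (lie X Y q) = coef (F q) (tmap F q (lie X Y q)) *m Fr q.
  by rewrite Frq coefK.
have E := etrans (esym (congr2 (fun u v => u - v) (dw Y (X q) hY1) (dw X (Y q) hX1)))
  (etrans (mderiv_lie O1o O1q sf hX1 hY1) lE).
apply: etrans (mulmx_solve _ E) (esym _); first exact: chart_frame_unit.
apply: etrans (frame_torsionE _ _ _) _.
by rewrite Frq (dFr (X q)) (dFr (Y q)).
Qed.

End Cartan.

(** * The identification of tangent vectors with vectors orthogonal to the normal *)

Lemma Ck_jacobian (R : realType) k n m (U : set 'rV[R]_n) (f : 'rV[R]_n -> 'rV[R]_m) :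
  open U -> Ck k.+1 U f -> Ck k U (jacobian f).
Proof.
move=> Uo [df Cf]; apply/(Ck_mxP _ _ Uo) => i j.
have /(Ck_mxP _ _ Uo)/(_ 0 j) := Cf (delta_mx 0 i).
apply: Ck_eq_open => // x Ux; apply: esym; apply: jacobian_entry; exact: df.
Qed.

Section ChartExtra.
Context {R : realType} {m : nat} {M : smoothManifold R m}.

Lemma smooth_fun_continuous (W : normedModType R) O (F : M -> W) q : open O ->
  smooth_fun O F -> O q -> {for q, continuous F}.
Proof.
move=> Oo hF Oq; set c := mf_chart q.
have cq : ch_dom c q := mf_chart_dom q.
have dF := smooth_fun_differentiable (mf_chart_atlas q) hF Oq cq.
have cF := continuous_comp (ch_map_cont cq) (differentiable_continuous dF).
move: cF; rewrite /prop_for /continuous_at /= ch_mapK //.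
apply: cvg_trans; apply: near_eq_cvg.
apply: filterS (open_nbhs_nbhs (conj (ch_open_dom c) cq)) => r cr /=.
by rewrite ch_mapK.
Qed.

Lemma smooth_fun_jacobian p' c O (f : M -> 'rV[R]_p') : mf_atlas c -> open O ->
  O `<=` ch_dom c -> smooth_fun O f ->
  smooth_fun O (fun q => jacobian (f \o ch_inv c) (ch_map c q)).
Proof.
move=> ac Oo Oc hf; apply: (smooth_fun_chart Oo ac Oc) => k.
have dO : ch_dom c `&` O = O.
  by apply/seteqP; split=> [q []|q Oq] //; split=> //; exact: Oc.
have Uo := chart_img_open c Oo; have := hf c ac k.+1; rewrite dO in Uo * => hfk.
apply: Ck_eq_open Uo _ (Ck_jacobian Uo hfk).
by move=> _ [q Oq <-] /=; rewrite ch_mapK //; exact: Oc.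
Qed.

(** The coordinate change is linear and injective, hence onto. *)
Lemma mderiv_ch_onto c (q : M) w : mf_atlas c -> ch_dom c q ->
  exists v, mderiv (ch_map c) q v = w.
Proof.
move=> ac cq; have sc := smooth_fun_atlas ac.
pose J : 'M[R]_m := \matrix_i mderiv (ch_map c) q (row i 1%:M).
have JE v : mderiv (ch_map c) q v = v *m J.
  rewrite -[in LHS](mulmx1 v) (mderiv_mulmxl cq _ _ sc) mulmx_sum_row.
  by apply: eq_bigr => i _; rewrite rowK.
have uJ : J \in unitmx.
  by apply: unitmx_kernel0 => a; rewrite -JE; exact: mderiv_ch_inj.
by exists (w *m invmx J); rewrite JE mulmxKV.
Qed.

End ChartExtra.

(** The rows of [A] span the complement of [y], so [y] completes them to a
    basis. *)
Lemma unitmx_col_normal (R : realType) n (y : 'rV[R]_n.+1) (A : 'M[R]_(n, n.+1)) :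
  dot y y = 1 -> (forall a, dot y (a *m A) = 0) ->
  (forall a : 'rV[R]_n, a *m A = 0 -> a = 0) ->
  (col_mx y A : 'M[R]_(1 + n)) \in unitmx.
Proof.
move=> y1 yA injA; apply: unitmx_kernel0 => a.
rewrite -[a]hsubmxK mul_row_col [lsubmx a]mx11_scalar mul_scalar_mx => E.
have l0 : lsubmx a 0 0 = 0.
  have := congr1 (dot y) E; rewrite dotDr dotZr y1 yA mulr1 addr0.
  by rewrite dot0r.
rewrite l0 scale0r add0r in E; rewrite l0 (injA _ E).
by rewrite raddf0 row_mx0.
Qed.

Section PhiAlgebra.
Context {R : realType} {n : nat} {Mt : weitzenbock R n.+1} {M : hypersurface Mt}.
Variables (N : M -> 'rV[R]_n.+1) (normal_N : unit_normal N).
Implicit Types (p q : M) (u v : 'rV[R]_n).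
Local Notation inc := (@hs_inc R n Mt M).
Local Notation g := (gauss_map N).

Lemma hs_inc_smooth : smooth_map inc.
Proof. exact: emb_smooth (hs_embedding M). Qed.

Lemma gauss_sphere q : sphere (g q).
Proof. exact: un_unit normal_N q. Qed.

Lemma gauss_smooth : smooth_fun setT g.
Proof. exact: un_smooth normal_N. Qed.

Lemma dot_gauss_phi q v : dot (g q) (phi q v) = 0.
Proof. exact: un_normal normal_N q v. Qed.

Definition phi_mx q : 'M[R]_(n, n.+1) := \matrix_i phi q (row i 1%:M).

Lemma phiE q v : phi q v = v *m phi_mx q.
Proof.
have ac := mf_chart_atlas (inc q).
have cq : (inc @^-1` ch_dom (mf_chart (inc q))) q := mf_chart_dom (inc q).
have sf := hs_inc_smooth.2 _ ac.
rewrite /phi /tmap -[in LHS](mulmx1 v) (mderiv_mulmxl cq _ _ sf).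
rewrite mulmx_sum_row /coef mulmx_suml.
by apply: eq_bigr => i _; rewrite -scalemxAl rowK.
Qed.

Lemma phi_inj q : injective (phi q).
Proof.
move=> u v E; apply: (emb_immersion (hs_embedding M) (p := q)).
exact: (can_inj (g := mulmx^~ (wz_frame (inc q))) (coefK (inc q)) E).
Qed.

Lemma phi0 q : phi q 0 = 0.
Proof. by rewrite phiE mul0mx. Qed.

Lemma phi_onto q w : dot (g q) w = 0 -> phi q (phi_inv q w) = w.
Proof.
move=> gw; suff : exists v, phi q v = w 
  by rewrite /phi_inv; case: xgetP => [v _ -> //|nex [v vw]]; case: (nex v).
pose S : 'M[R]_(1 + n) := col_mx (g q) (phi_mx q).
have uS : S \in unitmx.
  apply: unitmx_col_normal => [|a|a]; first exact: gauss_sphere.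
    by rewrite -phiE dot_gauss_phi.
  by rewrite -phiE -(phi0 q) => /phi_inj.
pose a : 'rV[R]_(1 + n) := (w : 'rV[R]_(1 + n)) *m invmx S.
have wE : (w : 'rV[R]_(1 + n)) = lsubmx a *m g q + rsubmx a *m phi_mx q.
  by rewrite -mul_row_col hsubmxK /a mulmxKV.
exists (rsubmx a); rewrite phiE wE.
move: gw; rewrite wE [lsubmx a]mx11_scalar mul_scalar_mx dotDr dotZr.
rewrite gauss_sphere -phiE dot_gauss_phi mulr1 addr0 => ->.
by rewrite scale0r add0r.
Qed.

End PhiAlgebra.

(** * Local orthonormal frames *)

Section Householder.
Context {R : realType} {n : nat}.
Implicit Types (y : 'rV[R]_n.+1) (i j : 'I_n).

(** The row of index [i + 1] of the reflection that exchanges the unit vector [y]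
    and [s] times the first basis vector, where [s] is a sign; since
    [|y - s e_0|^2 = 2 (1 - s y_0)], no square root is involved. *)
Definition householder (s : R) y i : 'rV[R]_n.+1 :=
  delta_mx 0 (lift ord0 i)
  - (y 0 (lift ord0 i) / (1 - s * y 0 ord0)) *: (y - s *: delta_mx 0 ord0).

Lemma dot_delta_delta (a b : 'I_n.+1) :
  dot (delta_mx 0 a : 'rV[R]_n.+1) (delta_mx 0 b) = (a == b)%:R.
Proof. by rewrite dot_delta mxE eqxx eq_sym. Qed.

Lemma dot_householder_l s y i : dot y y = 1 -> 1 - s * y 0 ord0 != 0 ->
  dot y (householder s y i) = 0.
Proof.
move=> y1 d0; rewrite dotBr dotZr dotBr dotZr !dot_delta y1.
by rewrite divfK // subrr.
Qed.

Lemma dot_householder s y i j : s * s = 1 -> dot y y = 1 ->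
  1 - s * y 0 ord0 != 0 ->
  dot (householder s y i) (householder s y j) = (i == j)%:R.
Proof.
move=> s1 y1 d0; rewrite /householder !(dotBl, dotBr, dotZl, dotZr).
rewrite !dot_delta_delta !(dotC (delta_mx _ _) y) !dot_delta y1 /=.
rewrite (inj_eq lift_inj).
have [h hE] : exists h, h = 1 - s * y 0 ord0 by eexists.
rewrite -hE in d0 *.
move: (y 0 (lift ord0 i)) (y 0 (lift ord0 j)) (_%:R) => a b e.
have -> : s * (0 - b / h * (y 0 ord0 - s * 1)) = b.
  have -> : s * (0 - b / h * (y 0 ord0 - s * 1)) =
      b / h * (s * s - s * y 0 ord0) by ring.
  by rewrite s1 -hE divfK.
by rewrite divfK //; ring.
Qed.

End Householder.

Section Onframe.
Context {R : realType} {n : nat} {Mt : weitzenbock R n.+1} {M : hypersurface Mt}.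
Variables (N : M -> 'rV[R]_n.+1) (normal_N : unit_normal N).
Local Notation inc := (@hs_inc R n Mt M).
Local Notation g := (gauss_map N).

(** The matrix of [phi] relative to the coordinates of [c]; fixing the chart [c']
    of the ambient manifold makes it smooth in [q]. *)
Definition phi_chart (c : chart R n M) (c' : chart R n.+1 Mt) (q : M) : 'M[R]_(n, n.+1) :=
  jacobian ((ch_map c' \o inc) \o ch_inv c) (ch_map c q)
  *m invmx (chart_frame c' (inc q)).

Lemma phi_chartE (c : chart R n M) (c' : chart R n.+1 Mt) q v :
  mf_atlas c -> mf_atlas c' -> ch_dom c q -> ch_dom c' (inc q) ->
  phi q v = mderiv (ch_map c) q v *m phi_chart c c' q.
Proof.
move=> ac ac' cq cq'; have sf := (hs_inc_smooth (M := M)).2 c' ac'.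
rewrite /phi (coef_chart _ ac' cq').
rewrite -(mderiv_comp (O := ch_dom c') v hs_inc_smooth cq' (smooth_fun_atlas ac')).
rewrite (mderiv_chart v ac cq (O := inc @^-1` ch_dom c') cq' sf).
have d := smooth_fun_differentiable ac sf cq' cq.
by rewrite (deriveEjacobian _ d) mulmxA.
Qed.

(** The coordinates of [E] are obtained from [phi q (E q)] by inverting the
    matrix with rows the normal and [phi_chart], which is smooth in [q]. *)
Lemma smooth_field_of_phi (O : set M) (E : M -> 'rV[R]_n)
    (c' : chart R n.+1 Mt) : open O -> mf_atlas c' -> O `<=` inc @^-1` ch_dom c' ->
  smooth_fun O (fun q => phi q (E q)) -> smooth_field O E.
Proof.
move=> Oo ac' Oc' sE c ac; set O' := O `&` ch_dom c.
have O'o : open O' by apply: openI => //; exact: ch_open_dom.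
have inO' q : O' q -> ch_dom c q /\ ch_dom c' (inc q).
  by move=> [/Oc' ? ?].
pose S q : 'M[R]_(1 + n) := col_mx (g q) (phi_chart c c' q).
have uS q : O' q -> S q \in unitmx.
  move=> /inO' [cq cq'].
  have onto a : exists v, a *m phi_chart c c' q = phi q v /\ mderiv (ch_map c) q v = a.
    have [v vE] := mderiv_ch_onto a ac cq; exists v; split=> //.
    by rewrite (phi_chartE v ac ac' cq cq') vE.
  apply: unitmx_col_normal => [|a|a].
  - exact: gauss_sphere normal_N q.
  - by have [v [-> _]] := onto a; exact: dot_gauss_phi normal_N q v.
  - have [v [-> <-]] := onto a; rewrite -(phi0 q) => /phi_inj ->.
    exact: mderiv0.
have sS : smooth_fun O' S.
  have sg : smooth_fun O' g by apply: smooth_fun_sub (gauss_smooth normal_N).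
  have sp : smooth_fun O' (phi_chart c c').
    apply: smooth_fun_mulmx => //.
      apply: smooth_fun_jacobian => //; first by move=> q [].
      by apply: smooth_fun_sub (hs_inc_smooth.2 c' ac') => q /inO' [].
    apply: smooth_fun_invmx => // [q /inO' [_ cq']|].
      exact: chart_frame_unit.
    apply: smooth_fun_sub (smooth_fun_comp hs_inc_smooth (ch_open_dom c')
      (smooth_chart_frame ac')).
    by move=> q /inO' [].
  apply/(smooth_fun_mxP _ O'o) => i j.
  have /(smooth_fun_mxP _ O'o) sge := sg; have /(smooth_fun_mxP _ O'o) spe := sp.
  case: (split_ordP i) => k ->.
    apply: smooth_fun_eq O'o _ (sge k j) => q _.
    by rewrite /S [RHS](@col_mxEu R 1 n n.+1).
  apply: smooth_fun_eq O'o _ (spe k j) => q _.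
  by rewrite /S [RHS](@col_mxEd R 1 n n.+1).
pose K : 'M[R]_(1 + n, n) := col_mx 0 1%:M.
apply: (@smooth_fun_eq _ _ _ _ _ (fun q =>
    ((phi q (E q) : 'rV[R]_(1 + n)) *m invmx (S q)) *m K)) => //.
  move=> q O'q; have [cq cq'] := inO' q O'q.
  have -> : (phi q (E q) : 'rV[R]_(1 + n)) = row_mx 0 (mderiv (ch_map c) q (E q)) *m S q.
    by rewrite /S mul_row_col mul0mx add0r -phi_chartE.
  by rewrite mulmxK ?uS // mul_row_col mul0mx add0r mulmx1.
apply: smooth_fun_mulmx => //; last exact: smooth_fun_cst.
apply: smooth_fun_mulmx => //; last exact: smooth_fun_invmx.
by apply: smooth_fun_sub sE => q [].
Qed.

(** A smooth orthonormal frame of the complement of the Gauss map comes from a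
    Householder reflection, without any orthonormalization process. *)
Lemma exists_local_onframe (p : M) : exists E, local_onframe p E.
Proof.
(* The sign keeps the denominator of the reflection away from zero at [p]. *)
pose s : R := if g p 0 ord0 <= 0 then 1 else -1.
have s1 : s * s = 1 by rewrite /s; case: ifP; rewrite ?mulr1 ?mulrNN ?mulr1.
have sp : 1 - s * g p 0 ord0 > 0.
  rewrite /s; case: ifPn => [|]; first by rewrite mul1r; lra.
  by rewrite -ltNge mulN1r; lra.
pose h q := 1 - s * g q 0 ord0.
have sg := gauss_smooth normal_N.
have /(smooth_fun_mxP _ openT) sge := sg.
have sh : smooth_fun setT h.
  apply: smooth_funD; [exact: openT|exact: smooth_fun_cst|].
  have -> : (fun q => - (s * g q 0 ord0)) = (fun q => (- s) * g q 0 ord0).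
    by apply/funext => q; rewrite mulNr.
  apply: smooth_funM; [exact: openT|exact: smooth_fun_cst|exact: sge].
pose c' := mf_chart (inc p); have ac' : mf_atlas c' := mf_chart_atlas _.
pose O := (h @^-1` [set x | 0 < x]) `&` (inc @^-1` ch_dom c').
have Oo : open O.
  apply: openI; apply: open_comp => [q _|].
  - exact: (smooth_fun_continuous openT sh).
  - exact: open_gt.
  - exact: hs_inc_smooth.1.
  - exact: ch_open_dom.
have Op : O p by split=> //; exact: mf_chart_dom.
have h0 q : O q -> h q != 0 by move=> [/lt0r_neq0].
pose e i q := householder s (g q) i.
pose E i q := phi_inv q (e i q).
have phiE q i : O q -> phi q (E i q) = e i q.
  move=> Oq; apply: (phi_onto normal_N).
  by apply: dot_householder_l; [exact: gauss_sphere normal_N q|exact: h0].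
exists E, O; split=> // [i|q Oq i j].
  apply: (smooth_field_of_phi (c' := c')) => //; first by move=> q [].
  apply: (@smooth_fun_eq _ _ _ _ _ (e i)) => // [q Oq|]; first by rewrite phiE.
  have sgO : smooth_fun O g by exact: smooth_fun_sub sg.
  have sgeO a b : smooth_fun O (fun q => g q a b) by exact: smooth_fun_sub (sge a b).
  apply: smooth_funB => //; first exact: smooth_fun_cst.
  apply: smooth_fun_scalemx => //.
    apply: smooth_funM => //; apply: smooth_funV => //.
    exact: smooth_fun_sub sh.
  by apply: smooth_funB => //; exact: smooth_fun_cst.
have -> : hs_metric q (E i q) (E j q) = dot (phi q (E i q)) (phi q (E j q)) by [].
by rewrite !phiE //; apply: dot_householder => //; [exact: gauss_sphere normal_N q|exact: h0].
Qed.

End Onframe.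

(** * Linear algebra of a unit vector and an orthonormal basis of its complement *)

Section NormalBasis.
Context {R : realType} {n : nat}.
Variables (y : 'rV[R]_n.+1) (e : 'I_n -> 'rV[R]_n.+1).
Hypotheses (y1 : dot y y = 1) (ye : forall i, dot y (e i) = 0)
  (ee : forall i j, dot (e i) (e j) = (i == j)%:R).
Implicit Types (u v w : 'rV[R]_n.+1) (A : 'M[R]_n.+1).

Let Q : 'M[R]_(1 + n) := col_mx y (\matrix_i e i).

Let QQ : Q *m Q^T = 1%:M.
Proof.
rewrite /Q tr_col_mx mul_col_row mulmx_dot y1.
have yE : y *m (\matrix_i e i)^T = 0.
  apply/rowP => j; rewrite [RHS]mxE -(ye j) mxE.
  by apply: eq_bigr => k _; rewrite !mxE.
have -> : (\matrix_i e i) *m y^T = 0.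
  by rewrite -[LHS]trmxK trmx_mul trmxK yE trmx0.
rewrite yE.
have -> : (\matrix_i e i) *m (\matrix_i e i)^T = 1%:M.
  apply/matrixP => i j; rewrite [RHS]mxE -ee mxE /dot.
  by apply: eq_bigr => k _; rewrite !mxE.
by rewrite [RHS]scalar_mx_block.
Qed.

Lemma normal_basis_trace A :
  \tr A = dot (y *m A) y + \sum_i dot (e i *m A) (e i).
Proof.
rewrite -[in LHS](mulmx1 (A : 'M[R]_(1 + n))) -(mulmx1C QQ) mulmxA mxtrace_mulC.
rewrite mulmxA /Q tr_col_mx mul_col_mx mul_col_row mxtrace_block.
rewrite [y *m A *m _]mulmx_dot mxtrace_scalar; congr (_ + _).
apply: eq_bigr => i _; rewrite dotE -[in RHS](rowK e i) -row_mul.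
by rewrite !mxE; apply: eq_bigr => k _; rewrite !mxE.
Qed.

Lemma normal_basis_decomp w :
  w = dot w y *: y + \sum_i dot w (e i) *: e i.
Proof.
rewrite -[LHS](mulmx1 (w : 'rV[R]_(1 + n))) -(mulmx1C QQ) mulmxA.
rewrite {2}/Q tr_col_mx mul_mx_row /Q mul_row_col mulmx_dot mul_scalar_mx.
congr (_ + _); rewrite mulmx_sum_row; apply: eq_bigr => i _.
rewrite rowK; congr (_ *: _).
by rewrite dotE !mxE; apply: eq_bigr => k _; rewrite !mxE.
Qed.

Lemma normal_basis_eq u v : dot u y = dot v y ->
  (forall i, dot u (e i) = dot v (e i)) -> u = v.
Proof.
move=> uy ue; rewrite (normal_basis_decomp u) (normal_basis_decomp v) uy.
by congr (_ + _); apply: eq_bigr => i _; rewrite ue.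
Qed.

Lemma normal_basis_mx_eq A B : y *m A = y *m B ->
  (forall i, e i *m A = e i *m B) -> A = B.
Proof.
move=> yE eE; have uQ : Q \in unitmx by have [] := mulmx1_unit QQ.
apply: (can_inj (mulKmx uQ)).
rewrite /Q !mul_col_mx yE; congr (col_mx _ _).
by apply/row_matrixP => i; rewrite !row_mul rowK eE.
Qed.

(** The algebra behind the theorem. Here [y] is the normal, [e] an orthonormal
    tangent frame, [L] (acting on rows) minus the Weingarten map extended by zero
    to the normal line, [DL i] its derivative along [e i], and [K a] the matrix of
    the torsion [b |-> T (a, b)]. The last two hypotheses are the Codazzi equation
    and the derivative of the skew part of [L]. Each of them exchanges two indices
    at the cost of a torsion term, and the two costs are the traces of [K L] and of
    [L K], which cancel. *)
Lemma divergence_trace (L : 'M[R]_n.+1) (DL : 'I_n -> 'M[R]_n.+1)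
    (K : 'rV[R]_n.+1 -> 'M[R]_n.+1) :
  y *m L = 0 -> L *m y^T = 0 ->
  (forall j, y *m DL j = - (e j *m L *m L)) ->
  (forall a, (K a)^T = - K a) ->
  (forall i j, e i *m DL j = e j *m DL i - e i *m K (e j) *m L) ->
  (forall i j, dot (e i *m DL i) (e j) - dot (e j *m DL i) (e i) =
               dot (e i *m L) (e i *m K (e j))) ->
  forall j, \sum_i dot (e i *m DL i) (e j) = \tr (DL j).
Proof.
move=> yL Ly yDL Kt codazzi skew_part j.
have Ly0 u : dot (u *m L) y = 0 by rewrite dotE -mulmxA Ly mulmx0 mxE.
rewrite normal_basis_trace yDL dotNl Ly0 oppr0 add0r.
have dot_tr u v A : dot (u *m A) v = dot u (v *m A^T).
  by rewrite !dotE trmx_mul trmxK mulmxA.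
have sumLK : \sum_i dot (e i *m L) (e i *m K (e j)) = - \tr (L *m K (e j)).
  rewrite normal_basis_trace mulmxA yL mul0mx dot0l add0r -sumrN.
  apply: eq_bigr => i _; rewrite mulmxA [in RHS]dot_tr Kt mulmxN dotNr.
  by rewrite opprK.
have sumKL : \sum_i dot (e i *m K (e j) *m L) (e i) = \tr (K (e j) *m L).
  rewrite normal_basis_trace mulmxA Ly0 add0r.
  by apply: eq_bigr => i _; rewrite mulmxA.
under [RHS]eq_bigr => i _ do rewrite codazzi dotBl.
rewrite sumrB sumKL mxtrace_mulC -sumLK -big_split /=.
by apply: eq_bigr => i _; rewrite -skew_part addrC subrK.
Qed.

End NormalBasis.

(** * The Weingarten map in a local orthonormal frame *)

Lemma dot_second_forms (R : realType) m (y di dj ei ej Dij Dji t l : 'rV[R]_m) :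
  dot di ej = - dot y Dij -> dot dj ei = - dot y Dji -> Dij - Dji = t + l ->
  dot y l = 0 -> dot di ej - dot dj ei = - dot y t.
Proof.
by move=> -> -> E yl; rewrite -opprD -dotBr E dotDr yl addr0.
Qed.

Lemma codazzi_algebra (R : nzRingType) m (L Xi Xj K : 'M[R]_m)
    (ei ej Dij Dji t l : 'rV[R]_m) :
  Dij *m L + ej *m Xi - (Dji *m L + ei *m Xj) = l *m L -> Dij - Dji = t + l ->
  t = - (ei *m K) -> ei *m Xj = ej *m Xi - ei *m K *m L.
Proof.
move=> E S tE; have := congr1 (mulmx^~ L) S; rewrite /= mulmxBl mulmxDl tE mulNmx.
rewrite -E; move: (Dij *m L) (Dji *m L) (ej *m Xi) (ei *m Xj) (ei *m K *m L).
move=> a b c x k; have -> : - k + (a + c - (b + x)) = (a - b) + (- k + (c - x)).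
  have -> : a + c - (b + x) = (a - b) + (c - x) by rewrite opprD addrACA.
  exact: addrCA.
move=> /(congr1 (fun z => - (a - b) + z)); rewrite addNr addKr => /esym/eqP.
by rewrite addrA subr_eq0 addrC => /eqP ->.
Qed.

Section Hypersurface.
Context {R : realType} {n : nat} {Mt : weitzenbock R n.+1} {M : hypersurface Mt}.
Variables (N : M -> 'rV[R]_n.+1) (normal_N : unit_normal N).
Local Notation inc := (@hs_inc R n Mt M).
Local Notation g := (gauss_map N).
Implicit Types (p q : M).

Lemma phi_nondegenerate q v w :
  (forall u, dot (phi q v) (phi q u) = dot w (phi q u)) ->
  phi q v = tangent_proj w (g q).
Proof.
move=> h; apply/eqP; rewrite -subr_eq0; apply/eqP; set z := _ - _.
have gS : dot (g q) (g q) = 1 := gauss_sphere normal_N q.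
have gp u : dot (g q) (phi q u) = 0 := dot_gauss_phi normal_N q u.
have gz : dot (g q) z = 0.
  by rewrite dotBr gp tangent_projE dotBr dotZr gS mulr1 subrr subr0.
apply: dot_eq0; rewrite -{2}(phi_onto normal_N gz) dotBl h.
by rewrite tangent_projE dotBl dotZl gp mulr0 subr0 subrr.
Qed.

Lemma phi_tangential q w :
  phi q (tangential q w) = tangent_proj (coef (inc q) w) (g q).
Proof.
apply: phi_nondegenerate; rewrite /tangential.
case: xgetP => [v _ vP u|nex]; first exact: vP.
have gt : dot (g q) (tangent_proj (coef (inc q) w) (g q)) = 0.
  by have [_] := sphere_field_tangent_proj (coef (inc q) w); apply; exact: gauss_sphere.
case: (nex (phi_inv q (tangent_proj (coef (inc q) w) (g q)))) => u /=.
rewrite /hs_metric /wz_metric -/(phi q u) -/(phi q (phi_inv _ _)).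
rewrite (phi_onto normal_N gt) tangent_projE dotBl dotZl.
by rewrite (dot_gauss_phi normal_N) mulr0 subr0.
Qed.

Section LocalFrame.
Variables (O : set M) (E : 'I_n -> M -> 'rV[R]_n).
Hypotheses (Oo : open O) (sE : forall i, smooth_field O (E i))
  (onE : forall q, O q -> forall i j, hs_metric q (E i q) (E j q) = (i == j)%:R).

Let e i q := phi q (E i q).
Let d i q := mderiv g q (E i q).

(** The differential of the Gauss map in frame coefficients, extended by zero to
    the normal line. Acting on a fixed Euclidean space, it can be differentiated
    entry by entry. *)
Definition gauss_mx q : 'M[R]_n.+1 := \sum_i (e i q)^T *m d i q.
Local Notation L := gauss_mx.

Let gS q : dot (g q) (g q) = 1. Proof. exact: gauss_sphere normal_N q. Qed.

Let ge q i : dot (g q) (e i q) = 0. Proof. exact: dot_gauss_phi normal_N q _. Qed.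

Let ee q : O q -> forall i j, dot (e i q) (e j q) = (i == j)%:R.
Proof. exact: onE. Qed.

Let gd q v : dot (g q) (mderiv g q v) = 0.
Proof.
exact: dot_mderiv_sphere (gauss_sphere normal_N) (gauss_smooth normal_N) q v.
Qed.

Let sg : smooth_fun O g. Proof. exact: smooth_fun_sub (gauss_smooth normal_N). Qed.

Let se (X : M -> 'rV[R]_n) : smooth_field O X -> smooth_fun O (fun q => phi q (X q)).
Proof. by move=> hX; exact: (smooth_pullback_coef hs_inc_smooth Oo hX). Qed.

Let sd i : smooth_fun O (d i). Proof. exact: smooth_fun_mderiv. Qed.

Lemma smooth_gauss_mx : smooth_fun O L.
Proof.
apply: smooth_fun_sum => // i; apply: smooth_fun_mulmx => //.
apply/(smooth_fun_mxP _ Oo) => a b; under eq_fun do rewrite mxE.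
by have /(smooth_fun_mxP _ Oo) := se (sE i); exact.
Qed.

Let normal_mul q : g q *m L q = 0.
Proof.
rewrite mulmx_sumr big1 // => i _.
by rewrite mulmxA mulmx_dot ge mul_scalar_mx scale0r.
Qed.

Let mul_normal q : L q *m (g q)^T = 0.
Proof.
rewrite mulmx_suml big1 // => i _.
by rewrite -mulmxA mulmx_dot dotC gd raddf0 mulmx0.
Qed.

Let frame_mul q i : O q -> e i q *m L q = d i q.
Proof.
move=> Oq; rewrite mulmx_sumr (bigD1 i) //= big1 => [|j ji].
  by rewrite mulmxA mulmx_dot ee // eqxx mul_scalar_mx scale1r addr0.
by rewrite mulmxA mulmx_dot ee // eq_sym (negbTE ji) mul_scalar_mx scale0r.
Qed.

Let tangent_decomp q v : O q -> v = \sum_i dot (phi q v) (e i q) *: E i q.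
Proof.
move=> Oq; apply: (@phi_inj _ _ _ _ q); rewrite [RHS]phiE mulmx_suml.
rewrite {1}(normal_basis_decomp (gS q) (ge q) (ee Oq) (phi q v)).
rewrite dotC (dot_gauss_phi normal_N) scale0r add0r.
by apply: eq_bigr => i _; rewrite -scalemxAl -phiE.
Qed.

Let linear_ext (W : normedModType R) (F : M -> W) q v : O q -> smooth_fun O F ->
  mderiv F q v = \sum_i dot (phi q v) (e i q) *: mderiv F q (E i q).
Proof.
move=> Oq hF; rewrite {1}(tangent_decomp v Oq).
elim: (index_enum _) => [|i s IH]; first by rewrite !big_nil mderiv0.
by rewrite !big_cons -IH (mderiv_linear _ _ _ Oq hF).
Qed.

Lemma phi_gauss_mx q v : O q -> phi q v *m L q = mderiv g q v.
Proof.
move=> Oq; rewrite (linear_ext v Oq sg).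
rewrite {1}(normal_basis_decomp (gS q) (ge q) (ee Oq) (phi q v)) mulmxDl.
rewrite -scalemxAl normal_mul scaler0 add0r mulmx_suml.
by apply: eq_bigr => i _; rewrite -scalemxAl frame_mul.
Qed.

(** Differentiate [dot g (phi Y) = 0]. *)
Lemma weingarten_phi q v : O q -> phi q (v *m weingarten N q) = - mderiv g q v.
Proof.
move=> Oq.
have amb Y x (O' : set M) : open O' -> O' q -> smooth_field O' Y ->
    wz_metric (inc q) (N q) (amb_nabla Y q x) = - dot (mderiv g q x) (phi q (Y q)).
  move=> O'o O'q sY; rewrite /wz_metric /amb_nabla /wz_conn coef_frame.
  have sY' := smooth_pullback_coef hs_inc_smooth O'o sY.
  have sg' : smooth_fun O' g by exact: smooth_fun_sub (gauss_smooth normal_N).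
  have := mderiv_dot O'q x sg' sY'.
  have -> : (fun r => dot (g r) (phi r (Y r))) = fun=> 0.
    by apply/funext => r; exact: dot_gauss_phi normal_N r _.
  rewrite mderiv_cst -/(g q) => /eqP.
  by rewrite eq_sym addrC addr_eq0 => /eqP.
suff WE : forall x i, dot (phi q (x *m weingarten N q)) (e i q) =
    - dot (mderiv g q x) (e i q).
  apply: (normal_basis_eq (gS q) (ge q) (ee Oq)) => [|i].
    by rewrite dotNl !(dotC _ (g q)) gd oppr0 (dot_gauss_phi normal_N).
  by rewrite WE dotNl.
move=> x i; rewrite -(amb _ x _ Oo Oq (sE i)) /weingarten.
case: xgetP => [W _ WP|nex]; first exact: (WP x O (E i) Oo Oq (sE i)).
pose W : 'M[R]_n := \matrix_j phi_inv q (- mderiv g q (row j 1%:M)).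
have WE z : phi q (z *m W) = - mderiv g q z.
  rewrite -[in RHS](mulmx1 z) (mderiv_mulmxl Oq _ _ sg) phiE.
  rewrite (mulmx_sum_row z) mulmx_suml -sumrN; apply: eq_bigr => j _.
  rewrite rowK -scalemxAl -phiE (phi_onto normal_N) ?scalerN //.
  by rewrite dotNr gd oppr0.
case: (nex W) => z O' Y O'o O'q sY; rewrite (amb Y z O' O'o O'q sY).
by rewrite /hs_metric /wz_metric -/(phi q (z *m W)) -/(phi q (Y q)) WE dotNl.
Qed.

(** The frame vectors [E i] conjugate the Weingarten matrix into the negative of
    the tangential block of [gauss_mx], and the normal block is zero. *)
Lemma mean_curvatureE q : O q -> mean_curvature N q = - \tr (L q).
Proof.
move=> Oq; rewrite /mean_curvature; set W := weingarten N q.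
pose eM : 'M[R]_(n, n.+1) := \matrix_i e i q; pose EM : 'M[R]_n := \matrix_i E i q.
have eME : eM = EM *m phi_mx q.
  by apply/row_matrixP => i; rewrite row_mul !rowK /e phiE.
have WL : W *m phi_mx q = - (phi_mx q *m L q).
  apply/row_matrixP => i; rewrite rowE [in RHS]rowE mulmxA -phiE weingarten_phi //.
  by rewrite -phi_gauss_mx // phiE mulmxN mulmxA.
have ee1 : EM *m (phi_mx q *m eM^T) = 1%:M.
  rewrite mulmxA -eME; apply/matrixP => i j; rewrite mxE [RHS]mxE -(ee Oq).
  by apply: eq_bigr => k _; rewrite [eM^T _ _]mxE ![eM _ _]mxE.
have trL : \tr (L q) = \tr (eM *m L q *m eM^T).
  rewrite (normal_basis_trace (gS q) (ge q) (ee Oq)) normal_mul dot0l add0r.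
  apply: eq_bigr => i _; have <- : row i (eM *m L q) = e i q *m L q.
    by rewrite row_mul rowK.
  move: (eM *m L q) => A; rewrite [RHS]mxE; apply: eq_bigr => k _.
  by rewrite [row _ _ _ _]mxE [_^T _ _]mxE [eM _ _]mxE.
have eL : eM *m L q = - (EM *m W *m phi_mx q).
  by rewrite eME -!mulmxA WL mulmxN opprK.
rewrite trL eL mulNmx raddfN /= opprK -(mulmxA (EM *m W)) -(mulmxA EM).
by rewrite mxtrace_mulC -(mulmxA W) (mulmx1C ee1) mulmx1.
Qed.

Let structure q i j : O q ->
  mderiv (e j) q (E i q) - mderiv (e i) q (E j q) =
  frame_torsion (inc q) (e i q) (e j q) + phi q (lie (E i) (E j) q).
Proof.
move=> Oq; have S := structure_equation hs_inc_smooth Oo Oq (sE i) (sE j).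
exact: canRL (subrK _) S.
Qed.

Let second_form q i j : O q ->
  dot (d i q) (e j q) = - dot (g q) (mderiv (e j) q (E i q)).
Proof.
move=> Oq; have := mderiv_dot Oq (E i q) sg (se (sE j)).
have -> : (fun r => dot (g r) (phi r (E j r))) = fun=> 0.
  by apply/funext => r; exact: ge.
by rewrite mderiv_cst => /eqP; rewrite eq_sym addr_eq0 => /eqP.
Qed.

Variable (skew_T : skew_torsion Mt).

Let skew q a b c :
  dot a (frame_torsion (inc q) b c) = - dot c (frame_torsion (inc q) b a).
Proof. exact: skew_frame_torsion. Qed.

Let tors_self q a : frame_torsion (inc q) a a = 0.
Proof.
have := frame_torsionC (inc q) a a.
by move/eqP; rewrite -addr_eq0 -mulr2n -scaler_nat scaler_eq0 pnatr_eq0 => /eqP.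
Qed.

(** The Weingarten map is not symmetric in the presence of torsion: its skew part
    is the normal component of the torsion. For frame vectors this is the
    structure equation paired with the normal; if [u] or [v] is normal, both
    sides vanish because the torsion is alternating. *)
Lemma gauss_mx_skew q u v : O q ->
  dot (u *m L q) v + dot (g q) (frame_torsion (inc q) u v) = dot (v *m L q) u.
Proof.
move=> Oq; have Lg a : dot (a *m L q) (g q) = 0.
  by rewrite dotE -mulmxA mul_normal mulmx0 mxE.
have dotT a b : dot (a *m (L q)^T) b = dot (b *m L q) a.
  by rewrite (dotC (b *m _)) !dotE trmx_mul mulmxA.
have dotK a b : dot (a *m torsion_mx (inc q) (g q)) b =
    dot (g q) (frame_torsion (inc q) a b).
  by rewrite -torsion_mxE frame_torsionC dotNl dotC -skew.
have red a b :
    dot (a *m L q) b - dot (b *m L q) a = - dot (g q) (frame_torsion (inc q) a b) ->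
    dot (a *m (L q - (L q)^T)) b = dot (a *m - torsion_mx (inc q) (g q)) b.
  by rewrite mulmxBr mulmxN dotBl dotNl dotT dotK.
have tg a : dot (g q) (frame_torsion (inc q) (g q) a) = 0.
  by rewrite skew tors_self dot0r oppr0.
suff LE : L q - (L q)^T = - torsion_mx (inc q) (g q).
  have /eqP := congr1 (fun A => dot (u *m A) v) LE.
  by rewrite mulmxBr mulmxN dotBl dotNl dotT dotK subr_eq addrC eq_sym subr_eq => /eqP.
apply: (normal_basis_mx_eq (gS q) (ge q) (ee Oq)) => [|i].
  by apply: (normal_basis_eq (gS q) (ge q) (ee Oq)) => [|j]; apply: red;
     rewrite tg normal_mul dot0l ?Lg subrr oppr0.
apply: (normal_basis_eq (gS q) (ge q) (ee Oq)) => [|j]; apply: red.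
  by rewrite frame_torsionC dotNr tg normal_mul dot0l Lg subrr !oppr0.
apply: etrans (congr2 (fun a b => dot a _ - dot b _) (frame_mul i Oq) (frame_mul j Oq)) _.
exact: (dot_second_forms (second_form i j Oq) (second_form j i Oq) (structure i j Oq)
  (dot_gauss_phi normal_N _ _)).
Qed.

(** The Codazzi equation: [mderiv_lie] for the Gauss map, with the derivatives of
    the frame replaced by the structure equation. *)
Lemma gauss_mx_codazzi q i j : O q ->
  e i q *m mderiv L q (E j q) =
  e j q *m mderiv L q (E i q) - e i q *m torsion_mx (inc q) (e j q) *m L q.
Proof.
move=> Oq.
have dE a b : mderiv (d b) q (E a q) =
    mderiv (e b) q (E a q) *m L q + e b q *m mderiv L q (E a q).
  rewrite -(mderiv_mulmx Oq (E a q) (se (sE b)) smooth_gauss_mx).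
  by apply: (mderiv_near_eq _ Oo Oq) => r Or; rewrite [RHS]frame_mul.
have lE : mderiv (d j) q (E i q) - mderiv (d i) q (E j q) =
    mderiv g q (lie (E i) (E j) q) := mderiv_lie Oo Oq sg (sE i) (sE j).
have E1 := etrans (esym (congr2 (fun a b => a - b) (dE i j) (dE j i)))
  (etrans lE (esym (phi_gauss_mx _ Oq))).
apply: (codazzi_algebra E1 (structure i j Oq)).
by rewrite frame_torsionC -torsion_mxE.
Qed.

Hypothesis (par_T : parallel_torsion Mt).

(** The derivative of [gauss_mx_skew] for constant [u] and [v]. The torsion has
    constant coefficients, so only the derivative of the normal appears. *)
Lemma gauss_mx_skew_derive q x u v : O q ->
  dot (u *m mderiv L q x) v - dot (v *m mderiv L q x) u =
  dot (mderiv g q x) (frame_torsion (inc q) v u).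
Proof.
move=> Oq; have sL := smooth_gauss_mx.
have cst (W : normedModType R) (a : W) : smooth_fun O (fun=> a) := smooth_fun_cst O a.
have suL (a : 'rV[R]_n.+1) : smooth_fun O (fun r => a *m L r) := smooth_fun_mulmx Oo (cst _ a) sL.
have duL a b : mderiv (fun r => dot (a *m L r) b) q x = dot (a *m mderiv L q x) b.
  rewrite (mderiv_dot Oq x (suL a) (cst _ b)) mderiv_cst dot0r addr0.
  by rewrite (mderiv_mulmx Oq x (cst _ a) sL) mderiv_cst mul0mx add0r.
have st : smooth_fun O (fun r => frame_torsion (inc r) u v).
  apply: smooth_fun_sub (smooth_fun_comp hs_inc_smooth openT (smooth_frame_torsion u v)).
  by [].
have dt : mderiv (fun r => frame_torsion (inc r) u v) q x = 0.
  apply: etrans (mderiv_comp (O := setT) x hs_inc_smooth I (smooth_frame_torsion u v)) _.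
  exact: parallel_frame_torsion.
have := mderiv_near_eq x Oo Oq (fun r Or => gauss_mx_skew u v Or).
rewrite (mderivD Oq x (smooth_fun_dot Oo (suL u) (cst _ v)) (smooth_fun_dot Oo sg st)).
rewrite !duL (mderiv_dot Oq x sg st) dt dot0r addr0 => <-.
by rewrite opprD addrA subrr sub0r -dotNr -frame_torsionC.
Qed.

Lemma mderiv_mean_curvature q x : O q ->
  mderiv (mean_curvature N) q x = - \tr (mderiv L q x).
Proof.
move=> Oq; rewrite (mderiv_near_eq x Oo Oq mean_curvatureE).
have dL := smooth_fun_differentiable_self Oq smooth_gauss_mx.
apply: etrans (deriveN (diff_derivable (differentiable_mxtrace dL))) _.
by rewrite derive_mxtrace.
Qed.

(** * The tension field in a local orthonormal frame *)

Section Tension.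
Variables (nablaS : 'rV[R]_n.+1 -> 'rV[R]_n.+1 ->
              ('rV[R]_n.+1 -> 'rV[R]_n.+1) -> 'rV[R]_n.+1)
    (LC_nablaS : levi_civita_sphere nablaS)
    (P : M -> 'rV[R]_n -> (M -> 'rV[R]_n.+1) -> 'rV[R]_n.+1)
    (pullback_P : pullback_connection nablaS g P).

(** Since [d g (E i)] is [e i *m L], the product rule produces one term with the
    derivative of [e i] and one with that of [L]. The first is cancelled by
    [d g] of the covariant derivative of [E i], because [L] kills the normal. *)
Lemma tension_summand q i : O q ->
  P q (E i q) (fun r => mderiv g r (E i r)) - mderiv g q (hs_nabla (E i) q (E i q))
  = tangent_proj (e i q *m mderiv L q (E i q)) (g q).
Proof.
move=> Oq; have pd : pullback_section g O (d i) by split=> // r _; exact: gd.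
have -> : P q (E i q) (fun r => mderiv g r (E i r)) =
    tangent_proj (mderiv (d i) q (E i q)) (g q).
  exact: (pullback_sphereE LC_nablaS pullback_P (gauss_sphere normal_N)
    (gauss_smooth normal_N) (E i q) Oo Oq pd).
have -> : mderiv (d i) q (E i q) =
    mderiv (e i) q (E i q) *m L q + e i q *m mderiv L q (E i q).
  rewrite -(mderiv_mulmx Oq (E i q) (se (sE i)) smooth_gauss_mx).
  by apply: (mderiv_near_eq _ Oo Oq) => r Or; rewrite [RHS]frame_mul.
rewrite -phi_gauss_mx // phi_tangential coef_frame.
have -> : mderiv (fun r => coef (inc r) (tmap inc r (E i r))) q (E i q) =
  mderiv (e i) q (E i q) by [].
move: (mderiv (e i) q _) (e i q *m _) => a b.
rewrite !tangent_projE mulmxBl -scalemxAl normal_mul scaler0 subr0 dotDr.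
have -> : dot (g q) (a *m L q) = 0 by rewrite dotC dotE -mulmxA mul_normal mulmx0 mxE.
by rewrite add0r -(addrA (a *m L q)) [LHS]addrC addKr.
Qed.

(** [divergence_trace] evaluates the sum of the summands against the frame
    vectors, and linearity extends the result to all tangent vectors. *)
Lemma tension_gradient q w : O q ->
  w = \sum_i (P q (E i q) (fun r => mderiv g r (E i r))
              - mderiv g q (hs_nabla (E i) q (E i q))) ->
  dot (g q) w = 0 /\
  forall x, dot w (phi q x) = - mderiv (mean_curvature N) q x.
Proof.
move=> Oq ->; under eq_bigr => i _ do rewrite tension_summand //.
split=> [|x].
  rewrite dotC dot_suml big1 // => i _; rewrite dotC tangent_projE dotBr dotZr.
  by rewrite gS mulr1 subrr.
rewrite (mderiv_mean_curvature _ Oq) opprK dot_suml.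
under eq_bigr => i _ do
  rewrite tangent_projE dotBl dotZl (dot_gauss_phi normal_N) mulr0 subr0.
have trE j : \sum_i dot (e i q *m mderiv L q (E i q)) (e j q) =
    \tr (mderiv L q (E j q)).
  apply: (divergence_trace (gS q) (ge q) (ee Oq) (K := torsion_mx (inc q))
    (normal_mul q) (mul_normal q) (DL := fun k => mderiv L q (E k q))) => [k|a|a b|a b].
  - have := mderiv_mulmx Oq (E k q) sg smooth_gauss_mx.
    have -> : (fun r => g r *m L r) = fun=> 0 by apply/funext => r; exact: normal_mul.
    rewrite mderiv_cst => /eqP; rewrite eq_sym addrC addr_eq0 => /eqP ->.
    by rewrite (frame_mul k Oq).
  - exact: torsion_mx_skew.
  - exact: gauss_mx_codazzi.
  - by rewrite gauss_mx_skew_derive // frame_mul // -torsion_mxE.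
rewrite (linear_ext x Oq smooth_gauss_mx) raddf_sum /=.
rewrite {1}(normal_basis_decomp (gS q) (ge q) (ee Oq) (phi q x)).
rewrite (dotC (phi q x) (g q)) (dot_gauss_phi normal_N) scale0r add0r.
have dot_sumr (w' : 'rV[R]_n.+1) (F : 'I_n -> 'rV[R]_n.+1) :
    dot w' (\sum_i F i) = \sum_i dot w' (F i).
  by rewrite dotC dot_suml; apply: eq_bigr => i _; exact: dotC.
under eq_bigr => i _ do rewrite dot_sumr.
rewrite exchange_big /=; apply: eq_bigr => j _.
under eq_bigr => i _ do rewrite dotZr.
by rewrite -mulr_sumr trE mxtraceZ.
Qed.

End Tension.

End LocalFrame.
End Hypersurface.

(** * The tension field and the gradient of the mean curvature *)

Lemma connected_locally_const (T : topologicalType) (S : Type) (f : T -> S) :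
  connected [set: T] -> (forall x, \forall y \near x, f y = f x) ->
  forall x y, f x = f y.
Proof.
move=> cT lf x y.
have op (A : set S) : open (f @^-1` A).
  by rewrite openE => z Az; apply: filterS (lf z) => w; rewrite /preimage /= => ->.
suff : [set z | f z = f y] = setT by move=> /seteqP [_ /(_ x I)].
apply: cT; first by exists y.
- by exists [set z | f z = f y]; [exact: (op [set f y])|rewrite setTI].
- exists [set z | f z = f y]; last by rewrite setTI.
  rewrite -openC; exact: (op (~` [set f y])).
Qed.

Lemma mderiv0_locally_const (R : realType) m (M : smoothManifold R m) (f : M -> R) :
  smooth_fun setT f -> (forall p v, mderiv f p v = 0) ->
  forall p, \forall q \near p, f q = f p.
Proof.
move=> sf f0 p; set c := mf_chart p.
have ac : mf_atlas c := mf_chart_atlas p; have cp : ch_dom c p := mf_chart_dom p.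
have Up : (ch_map c @` ch_dom c) (ch_map c p) by exists p.
have df y : (ch_map c @` ch_dom c) y -> differentiable (f \o ch_inv c) y.
  by move=> [q cq <-]; exact: (smooth_fun_differentiable ac sf I cq).
have D0 y v : (ch_map c @` ch_dom c) y -> 'D_v (f \o ch_inv c) y = 0.
  move=> [q cq <-]; have [u <-] := mderiv_ch_onto v ac cq.
  by rewrite -(mderiv_chart u ac cq (O := setT) I sf).
have := derive0_locally_const (ch_open_img (c := c)) Up df D0.
move=> /(ch_map_cont cp); rewrite /nbhs /=.
apply: filterS2 (open_nbhs_nbhs (conj (ch_open_dom c) cp)) => q cq /=.
by rewrite !ch_mapK.
Qed.

Section GaussTension.
Context {R : realType} {n : nat} {Mt : weitzenbock R n.+1} {M : hypersurface Mt}.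
Variables (N : M -> 'rV[R]_n.+1) (normal_N : unit_normal N).
Hypotheses (par_T : parallel_torsion Mt) (skew_T : skew_torsion Mt).
Local Notation g := (gauss_map N).
Local Notation H := (mean_curvature N).

Lemma smooth_mean_curvature : smooth_fun setT H.
Proof.
apply/smooth_fun_ptwise => p _.
have [E [A [Ao Ap sE onE]]] := exists_local_onframe normal_N p.
apply: (@smooth_fun_sub _ _ _ _ A); first by move=> _ ->.
have sL := smooth_gauss_mx normal_N Ao sE.
apply: (@smooth_fun_eq _ _ _ _ _ (fun q => (-1) * \sum_i gauss_mx N E q i i)) => //.
  by move=> q Aq; rewrite mulN1r (mean_curvatureE normal_N Ao sE onE Aq).
apply: smooth_funM => //; first exact: smooth_fun_cst.
apply: smooth_fun_sum => // i.
by have /(smooth_fun_mxP _ Ao) := sL; exact.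
Qed.

Variables (nablaS : 'rV[R]_n.+1 -> 'rV[R]_n.+1 ->
              ('rV[R]_n.+1 -> 'rV[R]_n.+1) -> 'rV[R]_n.+1)
    (LC_nablaS : levi_civita_sphere nablaS)
    (P : M -> 'rV[R]_n -> (M -> 'rV[R]_n.+1) -> 'rV[R]_n.+1)
    (pullback_P : pullback_connection nablaS g P).

(** The two properties determine the tension field, so its value does not depend
    on the chosen frame. *)
Lemma tension_fieldP p :
  dot (g p) (tension_field P g p) = 0 /\
  forall x, dot (tension_field P g p) (phi p x) = - mderiv H p x.
Proof.
rewrite /tension_field; case: xgetP => [w _ [E [A [Ao Ap sE onE]] wE]|nex].
  exact: (tension_gradient normal_N Ao sE onE skew_T par_T LC_nablaS pullback_P Ap wE).
have [E onE] := exists_local_onframe normal_N p.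
by case: (nex _ (ex_intro2 _ _ E onE erefl)).
Qed.

Lemma phi_tension p :
  phi p (phi_inv p (tension_field P g p)) = tension_field P g p.
Proof. by apply: (phi_onto normal_N); have [] := tension_fieldP p. Qed.

Lemma tension_grad p : - phi_inv p (tension_field P g p) = grad H p.
Proof.
have phiN v : phi p (- v) = - phi p v by rewrite !phiE mulNmx.
have tP x : hs_metric p (- phi_inv p (tension_field P g p)) x = mderiv H p x.
  rewrite /hs_metric /wz_metric -/(phi p (- _)) -/(phi p x) phiN phi_tension dotNl.
  by have [_ ->] := tension_fieldP p; rewrite opprK.
rewrite /grad; case: xgetP => [v _ vP|nex]; last by case: (nex _ tP).
apply: (@phi_inj _ _ _ _ p).
have proj u : (forall x, hs_metric p u x = mderiv H p x) ->
    forall x, dot (phi p u) (phi p x) = dot (phi p v) (phi p x).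
  by move=> uP x; rewrite -[LHS]/(hs_metric p u x) -[RHS]/(hs_metric p v x) uP vP.
apply: etrans (phi_nondegenerate normal_N (proj _ tP)) (esym _).
exact: (phi_nondegenerate normal_N (proj v vP)).
Qed.

Lemma tension_eq0 p : tension_field P g p = 0 <-> forall x, mderiv H p x = 0.
Proof.
have [gt tP] := tension_fieldP p; split=> [t0 x|H0].
  by apply/eqP; rewrite -oppr_eq0 -tP t0 dot0l.
by apply: dot_eq0; rewrite -{2}phi_tension tP H0 oppr0.
Qed.

End GaussTension.

Theorem theorem4 (R : realType) (n : nat) (Mt : weitzenbock R n.+1)
    (par_T : parallel_torsion Mt) (skew_T : skew_torsion Mt)
    (M : hypersurface Mt)
    (N : M -> 'rV[R]_n.+1) (normal_N : unit_normal N)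
    (nablaS : 'rV[R]_n.+1 -> 'rV[R]_n.+1 ->
              ('rV[R]_n.+1 -> 'rV[R]_n.+1) -> 'rV[R]_n.+1)
    (LC_nablaS : levi_civita_sphere nablaS)
    (P : M -> 'rV[R]_n -> (M -> 'rV[R]_n.+1) -> 'rV[R]_n.+1)
    (pullback_P : pullback_connection nablaS (gauss_map N) P) :
  (forall p : M,
     phi p (phi_inv p (tension_field P (gauss_map N) p)) = tension_field P (gauss_map N) p /\
     - phi_inv p (tension_field P (gauss_map N) p) = grad (mean_curvature N) p) /\
  (connected [set: M] ->
     harmonic_map P (gauss_map N) <-> exists c : R, forall p : M, mean_curvature N p = c).
Proof.
split=> [p|conn].
  split; first exact: (phi_tension normal_N par_T skew_T LC_nablaS pullback_P).
  exact: (tension_grad normal_N par_T skew_T LC_nablaS pullback_P).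
have t0 := tension_eq0 normal_N par_T skew_T LC_nablaS pullback_P.
split=> [harm|[c Hc] p].
  have H0 p v : mderiv (mean_curvature N) p v = 0 by apply: (t0 p).1; exact: harm.
  have lH := mderiv0_locally_const (smooth_mean_curvature normal_N) H0.
  have cH := connected_locally_const conn lH.
  have [[p0 _]|nM] := pselect (exists p : M, True).
    by exists (mean_curvature N p0) => p; exact: cH.
  by exists 0 => p; case: nM; exists p.
apply/(t0 p) => x; have -> : mean_curvature N = fun=> c by apply/funext.
exact: mderiv_cst.
Qed.
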